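(* Let $d$ be a fixed positive integer. Let $(p_n)_{n\ge 1}$ be a sequence of odd primes, $(\ell_n)_{n\ge 1}$ a sequence of positive integers, put $q_n = p_n^{\ell_n}$, and let $E_n \subset \mathbb{Z}_{q_n}^d$ be sets such that $|E_n| \gg \ell_n(\ell_n+1)\, q_n^{\frac{(2\ell_n-1)d}{2\ell_n} + \frac{1}{2\ell_n}}$, i.e. $$\frac{\ell_n(\ell_n+1)\, q_n^{\frac{(2\ell_n-1)d}{2\ell_n} + \frac{1}{2\ell_n}}}{|E_n|} \longrightarrow 0 \quad \text{as } n\to\infty .$$ Then for all sufficiently large $n$, $$\Delta(E_n) \supset \mathbb{Z}_{q_n}^{\times}.$$
   Context: For a positive integer $q$, $\mathbb{Z}_q = \mathbb{Z}/q\mathbb{Z}$ is the ring of integers modulo $q$ and $\mathbb{Z}_q^{\times}$ is its group of units. For $x = (x_1,\dots,x_d) \in \mathbb{Z}_q^d$, put $\|x\| = x_1^2 + \dots + x_d^2 \in \mathbb{Z}_q$. For $E \subset \mathbb{Z}_q^d$, the distance set is $\Delta(E) = \{\|x-y\| : x,y\in E\} \subset \mathbb{Z}_q$. The notation $X \gg Y$ means $Y = o(X)$. *)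

(* Defs.v *)
From mathcomp Require Import all_boot all_order all_algebra.
Set Implicit Arguments.
Unset Strict Implicit.
Unset Printing Implicit Defensive.
Import GRing.Theory.
Local Open Scope ring_scope.

(* In MathComp 'Z_q is the ring of integers modulo q only for 1 < q, so these
   definitions are meant to be used under that assumption. *)

Definition norm2 (q d : nat) (x : 'rV['Z_q]_d) : 'Z_q :=
  \sum_(i < d) x 0 i ^+ 2.

Definition distance_set (q d : nat) (E : {set 'rV['Z_q]_d}) : {set 'Z_q} :=
  [set norm2 (x - y) | x in E, y in E].

Definition Zunits (q : nat) : {set 'Z_q} := [set u | u \is a GRing.unit].

(* Main.v *)
Require Import Defs.
From HB Require Import structures.
From mathcomp Require Import all_boot all_order all_algebra all_solvable all_field.
From mathcomp Require Import zify ring.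
Set Implicit Arguments.
Unset Strict Implicit.
Unset Printing Implicit Defensive.
Import Order.TTheory GRing.Theory Num.Theory.
Local Open Scope ring_scope.

(** Write S for the sphere of unit radius t in Z_q^d, q = p^l.  If E has no pair at
    distance t, expanding the count of such pairs in characters gives
    |S| |E| <= q^d max |S^(m)| over the nonzero frequencies m, so it suffices that
    |S^(m)| <= C p^(-(d-1)/2) |S|.  The sphere is a union of fibers of reduction mod p,
    all of the same size c: the isometries z -> +-(reflection of z) act transitively on it.
    - If p^(l-1) does not divide m, rotations congruent to 1 modulo a high power of p
      multiply the sum over a fiber by a nontrivial root of unity, unless the fiber is
      parallel to m mod p; at most two fibers are, whence |S^(m)| <= 2c.
    - If p^(l-1) divides m, the sum is c times the one for the sphere over F_p, which
      Gauss sums turn into a Salie sum (d odd) or a Kloosterman sum (d even).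
    Weil's bound for Kloosterman sums is obtained by the Stepanov-Bombieri method over the
    tower of quadratic extensions of F_p: along it the sums satisfy K' = 2q - K^2, so one
    sum exceeding 2 sqrt p would grow too fast for the number of solutions of
    y^p - y = x + c/x. *)

(** * Stepanov's method for z^2 = (y^p - y)^2 - c *)

Lemma sumrX_pchar (R : comNzRingType) (p n : nat) (I : Type) (r : seq I) (P : pred I) (F : I -> R) :
  p \in [pchar R] -> p.-nat n -> (0 < n)%N ->
  (\sum_(i <- r | P i) F i) ^+ n = \sum_(i <- r | P i) F i ^+ n.
Proof.
move=> chp pn n0; apply: (big_morph (fun x => x ^+ n)) => [x y|].
  by apply: exprDn_pchar; rewrite (eq_pnat n (pcharf_eq chp)).
by rewrite expr0n eqn0Ngt n0.
Qed.

(** The coefficients of [P] act as digits in base ['X^N]: the lowest one equals a multiple of ['X^N]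
    of size at most [N], hence is zero, and the argument repeats on the rest. *)
Lemma poly_base_expansion_eq0 (F : fieldType) (N : nat) (P : {poly {poly F}}) :
  (forall j, (size (P`_j)%R <= N)%N) -> P.['X^N] = 0 -> P = 0.
Proof.
elim/poly_ind: P => [//|P c IH] sz.
rewrite hornerMXaddC => E.
have szc : (size c <= N)%N.
  by have := sz 0%N; rewrite coefD coefMX coefC /= add0r.
have szP j : (size (P`_j)%R <= N)%N.
  by have := sz j.+1; rewrite coefD coefMX coefC /= addr0.
have P0 : P.['X^N] = 0.
  apply/eqP; apply/negPn/negP => nz.
  have : c = - (P.['X^N] * 'X^N) by apply/eqP; rewrite -addr_eq0 addrC E.
  move/(congr1 (fun q : {poly F} => size q)); rewrite size_polyN size_mulXn // => Ec.
  by move: szc; rewrite Ec leqNgt -addn1 leq_add2l size_poly_gt0 nz.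
move: E; rewrite P0 mul0r add0r => ->.
by rewrite (IH szP P0) mul0r add0r polyC0.
Qed.

Lemma coef_size_mul (F : fieldType) (m n : nat) (P S : {poly {poly F}}) :
  (forall j, (size (P`_j)%R <= m.+1)%N) -> (forall j, (size (S`_j)%R <= n.+1)%N) ->
  forall j, (size ((P * S)`_j)%R <= (m + n).+1)%N.
Proof.
move=> hP hS j; rewrite coefM; apply: (leq_trans (size_sum _ _ _)).
apply/bigmax_leqP => i _; apply: (leq_trans (size_polyMleq _ _)).
have := hP i; have := hS (j - i)%N; lia.
Qed.

Section ArtinSchreierSquare.
Variables (L : finFieldType) (p : nat) (c : L).
Hypotheses (chp : p \in [pchar L]) (podd : odd p) (c0 : c != 0).

Let p_pr : prime p := pcharf_prime chp.
Let u : {poly L} := 'X^p - 'X.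
Let g : {poly L} := u ^+ 2 - c%:P.

Lemma two_neq0_pchar : 2%:R != 0 :> L.
Proof.
by rewrite -(dvdn_pcharf chp) dvdn_prime2 //; apply: contraL podd => /eqP ->.
Qed.

Lemma size_artin_schreier : size u = p.+1.
Proof.
rewrite /u size_polyDl ?size_polyXn // size_polyN size_polyX ltnS.
exact: prime_gt1.
Qed.

Lemma size_artin_schreier_sq : (size g <= (2 * p).+1)%N.
Proof.
apply: (leq_trans (size_polyD _ _)); rewrite size_polyN geq_max.
rewrite (leq_trans (size_polyC_leq1 _)) // andbT.
apply: (leq_trans (size_poly_exp_leq _ _)).
by rewrite size_artin_schreier /= mulnC.
Qed.

(** If [s] were nonzero, [g] would be a square [t^2] and [(u - t)(u + t) = c] a nonzero constant.
    Both factors would then be constant, and so would their sum [2u], although [u] has degree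
    [p]. *)
Lemma artin_schreier_sq_nonsquare (r s : {poly L}) : r ^+ 2 = g * s ^+ 2 -> s = 0.
Proof.
move=> E; apply/eqP/negPn/negP => s0.
have : s %| r.
  by rewrite -(@dvdp_pexp2r _ _ _ 2) // E dvdp_mulIr.
case/dvdpP => t Er.
have Et : t ^+ 2 = g.
  by apply: (mulIf (expf_neq0 2 s0)); rewrite -E Er exprMn.
have Eut : (u - t) * (u + t) = c%:P by rewrite -subr_sqr Et /g; ring.
have ct0 : c%:P != 0 :> {poly L} by rewrite polyC_eq0.
have nzm : u - t != 0 by apply: contraNneq ct0 => E0; rewrite -Eut E0 mul0r.
have nzp : u + t != 0 by apply: contraNneq ct0 => E0; rewrite -Eut E0 mulr0.
have szs : (size (u - t) + size (u + t)).-1 = 1%N.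
  by rewrite -size_mul // Eut size_polyC c0.
have szm : (0 < size (u - t)%R)%N by rewrite size_poly_gt0.
have szp : (0 < size (u + t)%R)%N by rewrite size_poly_gt0.
have : (size (u *+ 2)%R <= 1)%N.
  have -> : u *+ 2 = (u - t) + (u + t) by ring.
  apply: (leq_trans (size_polyD _ _)); rewrite geq_max; lia.
rewrite -scaler_nat size_scale ?two_neq0_pchar // size_artin_schreier.
by have := prime_gt1 p_pr; lia.
Qed.

Variables (Q h : nat).
Hypotheses (Qp : p.-nat Q) (Qh : Q = h.*2.+1) (ph : (p < h)%N) (cardL : #|L| = (Q ^ 2)%N).

(** [M] is the coefficient matrix of a polynomial in two variables; the outer variable stands for
    ['X^Q]. *)
Let bivar m n (M : 'M[L]_(m, n)) : {poly {poly L}} :=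
  \sum_(j < n) (\sum_(i < m) M i j *: 'X^i)%:P * 'X^j.

Lemma coef_bivar m n (M : 'M[L]_(m, n)) k :
  (bivar M)`_k = if insub k is Some j then \sum_(i < m) M i j *: 'X^i else 0.
Proof.
rewrite /bivar coef_sum; case: insubP => [j _ <-|nk].
  rewrite (bigD1 j) //= coefCM coefXn eqxx mulr1 [X in _ + X]big1 ?addr0 // => i ij.
  by rewrite coefCM coefXn eq_sym (inj_eq val_inj) (negbTE ij) mulr0.
rewrite big1 // => i _; rewrite coefCM coefXn.
by case: eqP => [E|]; rewrite ?mulr0 //; move: nk; rewrite E ltn_ord.
Qed.

Lemma size_coef_bivar m n (M : 'M[L]_(m, n)) k : (size ((bivar M)`_k)%R <= m)%N.
Proof.
rewrite coef_bivar; case: insubP => [j _ _|]; last by rewrite size_poly0.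
apply: (leq_trans (size_sum _ _ _)); apply/bigmax_leqP => i _.
by apply: (leq_trans (size_scale_leq _ _)); rewrite size_polyXn.
Qed.

Lemma bivar_eq0 m n (M : 'M[L]_(m, n)) : bivar M = 0 -> M = 0.
Proof.
move=> E; apply/matrixP => i j; rewrite mxE.
have := congr1 (fun P : {poly {poly L}} => P`_j`_i) E.
rewrite coef_bivar; case: insubP => [j' _ /val_inj ->|]; last by rewrite ltn_ord.
rewrite !coef0 coef_sum (bigD1 i) //= coefZ coefXn eqxx mulr1 big1 ?addr0 //.
by move=> k ki; rewrite coefZ coefXn eq_sym (inj_eq val_inj) (negbTE ki) mulr0.
Qed.

(** The same two-variable polynomial evaluated at [('X^s, 'X^t)]. The cases of interest are [(1, Q)]
    and [(Q, 1)], which the [Q]-th power map of [L] exchanges. *)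
Let bpoly m n (M : 'M[L]_(m, n)) (s t : nat) : {poly L} :=
  \sum_(j < n) \sum_(i < m) M i j *: 'X^(i * s + j * t).

Lemma size_bpoly m n (M : 'M[L]_(m, n)) s t :
  (size (bpoly M s t) <= (m.-1 * s + n.-1 * t).+1)%N.
Proof.
apply: (leq_trans (size_sum _ _ _)); apply/bigmax_leqP => j _.
apply: (leq_trans (size_sum _ _ _)); apply/bigmax_leqP => i _.
apply: (leq_trans (size_scale_leq _ _)); rewrite size_polyXn ltnS.
by apply: leq_add; rewrite leq_mul2r; apply/orP; right; have := ltn_ord i; have := ltn_ord j; lia.
Qed.

Lemma bpolyB m n (M N : 'M[L]_(m, n)) s t : bpoly (M - N) s t = bpoly M s t - bpoly N s t.
Proof.
rewrite /bpoly -sumrB; apply: eq_bigr => j _; rewrite -sumrB; apply: eq_bigr => i _.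
by rewrite !mxE scalerBl.
Qed.

Lemma horner_bivar m n (M : 'M[L]_(m, n)) : (bivar M).['X^Q] = bpoly M 1 Q.
Proof.
rewrite /bivar /bpoly horner_sum; apply: eq_bigr => j _.
rewrite hornerM hornerC hornerXn mulr_suml; apply: eq_bigr => i _.
by rewrite -scalerAl -exprM -exprD muln1 mulnC.
Qed.

Let Q_gt0 : (0 < Q)%N. Proof. by rewrite Qh. Qed.

Lemma expQQ (x : L) : (x ^+ Q) ^+ Q = x.
Proof. by rewrite -exprM mulnn -cardL expf_card. Qed.

(** Since [#|L| = Q^2], the map [x -> x^Q] is an additive involution of [L]; it swaps [y] and [y^Q]
    and undoes its own action on the coefficients. *)
Lemma bpoly_frobenius m n (M : 'M[L]_(m, n)) (y : L) :
  (bpoly (map_mx (fun a => a ^+ Q) M) 1 Q).[y] ^+ Q = (bpoly M Q 1).[y].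
Proof.
rewrite /bpoly !horner_sum (sumrX_pchar _ _ _ chp Qp Q_gt0); apply: eq_bigr => j _.
rewrite !horner_sum (sumrX_pchar _ _ _ chp Qp Q_gt0); apply: eq_bigr => i _.
rewrite mxE /= !hornerZ !hornerXn exprMn expQQ; congr (_ * _).
by rewrite !muln1 !exprD exprMn !exprM expQQ.
Qed.

(** The value [e = (Q + 1)/2] gives both [g^(2e) = g g^Q] and [e Q = (Q^2 - 1)/2 + e]. With
    [J1 = h + p + 1] there are [2h^2 + 2h - p] unknown coefficients in [(A, B)] against [2h^2 + p]
    conditions, so the pigeonhole amounts to [p < h]. *)
Let J1 := (h + p).+1.
Let e := h.+1.

(* Squaring turns a relation A + g^e B = 0 into A^2 = g g^Q B^2; as g^Q is a polynomial
   in X^Q and all coefficients have degree < Q, X and X^Q may be treated as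
   independent variables, and g would be a square. *)
Lemma auxiliary_polynomial_neq0 (A : 'M[L]_(h, J1)) (B : 'M[L]_(h - p, e)) :
  bpoly A 1 Q + g ^+ e * bpoly B 1 Q = 0 -> A = 0 /\ B = 0.
Proof.
move=> E.
(* [G] is [g^Q] written in the second variable: the [Q]-th power only moves the constant [c], so the
   coefficients of [G] are constants. *)
have [G [GQ csG lG]] : exists G : {poly {poly L}}, [/\ G.['X^Q] = g ^+ Q,
    (forall j, (size (G`_j)%R <= 1)%N) & lead_coef G = 1].
  pose G : {poly {poly L}} := ('X^p - 'X) ^+ 2 - (c ^+ Q)%:P%:P.
  have GQ : G.['X^Q] = g ^+ Q.
    rewrite /G /g !hornerE.
    have chpP : p \in [pchar {poly L}] by rewrite pchar_poly.
    have Qnat : [pchar {poly L}].-nat Q by rewrite (eq_pnat _ (pcharf_eq chpP)).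
    have DQ (a b : {poly L}) : (a - b) ^+ Q = a ^+ Q - b ^+ Q.
      rewrite exprDn_pchar //; congr (_ + _).
      rewrite -mulN1r exprMn.
      have -> : (-1) ^+ Q = -1 :> {poly L} by rewrite -signr_odd Qh /= odd_double /= expr1.
      by rewrite mulN1r.
    rewrite /u DQ polyC_exp -exprM mulnC exprM DQ; congr ((_ - _) ^+ 2 - _).
    by rewrite -!exprM mulnC.
  have csG j : (size (G`_j)%R <= 1)%N.
    rewrite /G sqrrB !coefD !coefN coefMn -!exprM -exprSr !coefXn coefC.
    set w := (_ + _ : {poly L}).
    suff -> : w = ((j == (p * 2)%N)%:R - (j == p.+1)%:R *+ 2 + (j == (1 * 2)%N)%:R
                     - (if j == 0%N then c ^+ Q else 0))%:P by exact: size_polyC_leq1.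
    rewrite /w; do 4!case: (_ == _);
      by rewrite /= ?polyC_exp !(polyCB, polyCD, polyCMn) ?polyC1 ?polyC0 ?polyC_exp.
  have lG : lead_coef G = 1.
    have sz1 : (1 < p)%N by exact: prime_gt1.
    have mon : ('X^p - 'X : {poly {poly L}}) \is monic.
      by rewrite monicE lead_coefDl ?lead_coefXn // size_polyN size_polyX size_polyXn ltnS.
    have szu : size ('X^p - 'X : {poly {poly L}}) = p.+1.
      by rewrite size_polyDl size_polyXn // size_polyN size_polyX ltnS.
    rewrite lead_coefDl ?lead_coef_exp ?(eqP mon) ?expr1n //.
    rewrite size_polyN (leq_ltn_trans (size_polyC_leq1 _)) //.
    have := size_exp ('X^p - 'X : {poly {poly L}}) 2; rewrite szu /=.
    by set w := size _ => H2; lia.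
  by exists G.
have HE : (bivar A ^+ 2 - g%:P * G * bivar B ^+ 2).['X^Q] = 0.
  rewrite !hornerE GQ !horner_bivar.
  have -> : bpoly A 1 Q = - (g ^+ e * bpoly B 1 Q) by apply/eqP; rewrite -addr_eq0 E.
  rewrite sqrrN exprMn -exprM -exprS.
  have -> : (e * 2 = Q.+1)%N by rewrite /e Qh; lia.
  by rewrite /= expr2 mulrA subrr.
have h1 : h = h.-1.+1 by lia.
have csA j : (size ((bivar A)`_j)%R <= h.-1.+1)%N by rewrite -h1 size_coef_bivar.
have csB j : (size ((bivar B)`_j)%R <= (h - p).-1.+1)%N.
  by apply: (leq_trans (size_coef_bivar _ _)); lia.
have csg j : (size ((g%:P : {poly {poly L}})`_j)%R <= (2 * p).+1)%N.
  by rewrite coefC; case: eqP; rewrite ?size_artin_schreier_sq // size_poly0.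
(* Both products have digits of size at most [2h - 1 < Q]; the [p] rows that [B] lacks compared with
   [A] absorb the degree [2p] of [g]. *)
have D0 : bivar A ^+ 2 - g%:P * G * bivar B ^+ 2 = 0.
  apply: (poly_base_expansion_eq0 _ HE) => j.
  rewrite coefB; apply: (leq_trans (size_polyD _ _)); rewrite size_polyN geq_max.
  apply/andP; split.
    by apply: (leq_trans (coef_size_mul csA csA j)); rewrite Qh; lia.
  apply: (leq_trans (coef_size_mul (coef_size_mul csg csG) (coef_size_mul csB csB) j)).
  by rewrite Qh; lia.
(* As [G] is monic in the second variable, the leading coefficients [r] of [bivar A] and [s] of
   [bivar B] satisfy [r^2 = g s^2], unless both vanish. *)
have B0 : bivar B = 0.
  have EL := congr1 lead_coef (subr0_eq D0).
  move: EL; rewrite lead_coef_exp lead_coefM lead_coef_exp lead_coefM lead_coefC lG mulr1.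
  by move/artin_schreier_sq_nonsquare/eqP; rewrite lead_coef_eq0 => /eqP.
have A0 : bivar A = 0.
  by move/eqP: D0; rewrite B0 expr0n mulr0 subr0 expf_eq0 => /andP[_ /eqP].
by split; apply: bivar_eq0.
Qed.

Lemma size_auxiliary m n s t (A : 'M[L]_(h, J1)) (B : 'M[L]_(h - p, e)) (k : L) :
  (s == 1%N) && (t == Q) || (s == Q) && (t == 1%N) ->
  m = h.-1 -> n = (h + p)%N ->
  (size (bpoly A s t + k *: (g ^+ e * bpoly B s t))%R <= (m * s + n * t).+1)%N.
Proof.
move=> st -> ->.
apply: (leq_trans (size_polyD _ _)); rewrite geq_max; apply/andP; split.
  exact: size_bpoly.
apply: (leq_trans (size_scale_leq _ _)).
apply: (leq_trans (size_polyMleq _ _)).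
have s1 := size_bpoly B s t.
have s2 := size_poly_exp_leq g e.
have s3 := size_artin_schreier_sq.
have s4 : (size (g ^+ e)%R <= (2 * p * e).+1)%N.
  by apply: (leq_trans s2); rewrite ltnS leq_mul2r; apply/orP; right; lia.
have : ((size (g ^+ e)%R + size (bpoly B s t)).-1 <=
    (2 * p * e + ((h - p).-1 * s + e.-1 * t)).+1)%N.
  by lia.
move=> H; apply: (leq_trans H); rewrite ltnS.
have [r Er] : exists r, h = (p + r).+1 by exists (h - p).-1; lia.
have -> : ((h - p).-1 = r)%N by lia.
rewrite /e /= in st *; have Qr : Q = (2 * (p + r).+1).+1 by lia.
by case/orP: st => /andP[/eqP -> /eqP ->]; rewrite Qr Er /=; lia.
Qed.

(* Pigeonhole: there are more pairs (A, B) than polynomials of the relevant size. *)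
Lemma auxiliary_relation :
  exists A : 'M[L]_(h, J1), exists B : 'M[L]_(h - p, e),
    (A, B) != (0, 0) /\ bpoly A Q 1 - g ^+ e * bpoly B Q 1 = 0.
Proof.
pose N := (h.-1 * Q + (h + p) * 1).+1.
pose W (x : 'M[L]_(h, J1) * 'M[L]_(h - p, e)) : {poly L} :=
  bpoly x.1 Q 1 - g ^+ e * bpoly x.2 Q 1.
have szW x : (size (W x) <= N)%N.
  rewrite /W -scaleN1r; apply: size_auxiliary => //; by rewrite !eqxx orbT.
pose f x : 'rV[L]_N := poly_rV (W x).
have /injectivePn[x [y xy Exy]] : ~~ injectiveb f.
  apply/negP => /injectiveP /leq_card.
  rewrite card_prod !card_mx -expnD leq_exp2l; last first.
    by rewrite cardL Qh; lia.
  have [r Er] : exists r, h = (p + r).+1 by exists (h - p).-1; lia.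
  have -> : (h - p = r.+1)%N by lia.
  have Qr : Q = (2 * (p + r).+1).+1 by lia.
  by rewrite /N /J1 /e Qr Er /=; lia.
exists (x.1 - y.1), (x.2 - y.2); split.
  apply: contraNneq xy => -[/eqP E1 /eqP E2].
  rewrite !subr_eq0 in E1 E2.
  by rewrite [x]surjective_pairing [y]surjective_pairing (eqP E1) (eqP E2).
have := congr1 rVpoly Exy; rewrite !poly_rV_K ?szW // /W => E.
by rewrite !bpolyB mulrBr; move/eqP: E; rewrite -subr_eq0 => /eqP E; rewrite -[RHS]E; ring.
Qed.

(* Let P be the combination of [auxiliary_polynomial_neq0] whose coefficients are the
   Q-th powers (hence also the Q-th roots, as |L| = Q^2) of those of a vanishing relation.
   Where g takes a nonsquare value, P^Q agrees with that relation, so P has a root. *)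
Lemma stepanov_nonsquare_count :
  (2 * #|[set y : L | (((y ^+ p - y) ^+ 2 - c) ^+ (Q ^ 2).-1./2 == -1)%R]| <= Q ^ 2 + 2 * p * Q)%N.
Proof.
have [A [B [AB E]]] := auxiliary_relation.
pose fr m n (M : 'M[L]_(m, n)) := map_mx (fun a => a ^+ Q) M.
pose P := bpoly (fr _ _ A) 1 Q + g ^+ e * bpoly (fr _ _ B) 1 Q.
have fr0 m n (M : 'M[L]_(m, n)) : fr _ _ M = 0 -> M = 0.
  move=> /matrixP M0; apply/matrixP => i j; have := M0 i j.
  by rewrite !mxE => /eqP; rewrite expf_eq0 => /andP[_ /eqP].
have P0 : P != 0.
  apply: contraNneq AB => /auxiliary_polynomial_neq0[/fr0 -> /fr0 ->] //.
have szP : (size P <= (h.-1 * 1 + (h + p) * Q).+1)%N.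
  by rewrite /P -[X in _ + X]scale1r; apply: size_auxiliary => //; rewrite !eqxx.
set S := [set y | _].
have rS : all (root P) (enum S).
  apply/allP => y; rewrite mem_enum inE => /eqP gy.
  have {}gy : g.[y] ^+ (Q ^ 2).-1./2 = -1.
    by rewrite -gy /g /u !hornerE.
  apply/rootP/eqP.
  have -> : (P.[y] == 0) = (P.[y] ^+ Q == 0) by rewrite expf_eq0 Q_gt0.
  have Qnat : [pchar L].-nat Q by rewrite (eq_pnat _ (pcharf_eq chp)).
  rewrite /P hornerD exprDn_pchar // bpoly_frobenius hornerM exprMn bpoly_frobenius.
  rewrite horner_exp -exprM.
  have -> : (e * Q = (Q ^ 2).-1./2 + e)%N.
    rewrite /e Qh; set z := (_ ^ 2)%N.
    have -> : z = (2 * (2 * h * h + 2 * h)).+1 by rewrite /z -mulnn; lia.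
    by rewrite /= mul2n doubleK; lia.
  by rewrite exprD gy mulN1r mulNr -horner_exp -hornerM -hornerN -hornerD E horner0.
have := max_poly_roots P0 rS (enum_uniq _); rewrite -cardE => H.
have H2 : (#|S| <= h.-1 + (h + p) * Q)%N by rewrite -ltnS -[h.-1]muln1 (leq_trans H szP).
apply: (leq_trans (leq_mul (leqnn 2) H2)); clear -ph Qh.
have [r Er] : exists r, h = r.+1 by exists h.-1; lia.
have Qr : Q = (2 * r.+1).+1 by lia.
by rewrite Qr Er /= -mulnn; lia.
Qed.

End ArtinSchreierSquare.

(** * Kloosterman sums and quadratic extensions *)

Definition addchar (V : zmodType) (chi : V -> algC) :=
  (forall x y, chi (x + y) = chi x * chi y) /\ (forall x, `|chi x| = 1).

Section AddChar.
Variables (V : zmodType) (chi : V -> algC).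
Hypothesis chiP : addchar chi.

Lemma addchar_neq0 x : chi x != 0.
Proof. by rewrite -normr_eq0 chiP.2 oner_eq0. Qed.

Lemma addchar0 : chi 0 = 1.
Proof. by apply: (mulfI (addchar_neq0 0)); rewrite -chiP.1 addr0 mulr1. Qed.

Lemma addcharN x : chi (- x) = (chi x)^-1.
Proof.
by apply: (mulfI (addchar_neq0 x)); rewrite -chiP.1 subrr addchar0 divff // addchar_neq0.
Qed.

Lemma conj_addchar x : (chi x)^* = chi (- x).
Proof. by rewrite addcharN invC_norm chiP.2 expr1n invr1 mul1r. Qed.

End AddChar.

Lemma sum_addchar (V : finZmodType) (chi : V -> algC) (a : V) :
  addchar chi -> chi a != 1 -> \sum_x chi x = 0.
Proof.
move=> [chiD _] ca; apply/eqP.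
have : (1 - chi a) * \sum_x chi x = 0.
  rewrite mulrBl mul1r mulr_sumr [X in X - _](reindex_inj (addrI a)) /=.
  by apply/eqP; rewrite subr_eq0; apply/eqP/eq_bigr => x _; rewrite chiD.
by move/eqP; rewrite mulf_eq0 subr_eq0 eq_sym (negbTE ca).
Qed.

Lemma sum_addchar_scaled (F : finFieldType) (chi : F -> algC) (a t : F) :
  addchar chi -> chi a != 1 -> \sum_x chi (x * t) = if t == 0 then #|F|%:R else 0.
Proof.
move=> chiP ca; case: eqP => [->|/eqP t0].
  under eq_bigr do rewrite mulr0 (addchar0 chiP).
  by rewrite sumr_const.
by rewrite -[RHS](sum_addchar chiP ca) [RHS](reindex_inj (mulIf t0)).
Qed.

Definition kloosterman (F : finFieldType) (chi : F -> algC) (c : F) : algC :=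
  \sum_(x : F | x != 0) chi (x + c / x).

Lemma kloosterman_real (F : finFieldType) (chi : F -> algC) (c : F) :
  addchar chi -> kloosterman chi c \is Num.real.
Proof.
move=> chiP; apply/CrealP; rewrite rmorph_sum /= /kloosterman.
rewrite [RHS](reindex_inj oppr_inj) /=; apply: eq_big => [x|x _]; first by rewrite oppr_eq0.
by rewrite conj_addchar // invrN mulrN opprD.
Qed.

(** * Squares in finite fields of odd order *)

Section OddFiniteField.
Variable F : finFieldType.
Hypothesis oddF : odd #|F|.

Let card_gt1 : (1 < #|F|)%N := finNzRing_gt1 F.

Lemma primitive_element : exists g : F, #|F|.-1.-primitive_root g.
Proof.
have F1 : (0 < #|F|.-1)%N by move: card_gt1; lia.
pose rs := enum [pred x : F | x != 0].
have szrs : size rs = #|F|.-1.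
  by rewrite -cardE -(cardC1 (0 : F)).
have H : has #|F|.-1.-primitive_root rs.
  apply: has_prim_root => //; rewrite ?enum_uniq ?szrs //.
  apply/allP => x; rewrite mem_enum inE => x0; rewrite unity_rootE.
  apply/eqP; apply: (mulfI x0); rewrite -exprS prednK ?expf_card ?mulr1 //.
  by move: card_gt1; lia.
by have [g _ Hg] := hasP H; exists g.
Qed.

Lemma finfield_square (y : F) : y ^+ #|F|.-1./2 = 1 -> exists w, w ^+ 2 = y.
Proof.
have [g Hg] := primitive_element => y1.
have : y ^+ #|F|.-1 = 1.
  have -> : (#|F|.-1 = #|F|.-1./2 * 2)%N.
    by move: card_gt1 oddF; lia.
  by rewrite exprM y1 expr1n.
case/(prim_rootP Hg) => [[k _] /= Ek]; move/eqP: y1.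
rewrite Ek -exprM -(prim_order_dvd Hg) => /dvdnP[m Em].
exists (g ^+ m); rewrite -exprM; congr (_ ^+ _).
have [r Er] : exists r, #|F| = (r.+1).*2.+1.
  by exists (#|F|./2).-1; move: card_gt1 oddF; lia.
move: Em; rewrite Er /= doubleK; nia.
Qed.

Lemma finfield_euler (y : F) : y != 0 -> y ^+ #|F|.-1./2 != -1 -> exists w, w ^+ 2 = y.
Proof.
move=> y0 y1; apply: finfield_square.
have : y ^+ #|F|.-1 = 1.
  apply: (mulfI y0); rewrite -exprS prednK ?expf_card ?mulr1 //.
  by move: card_gt1; lia.
have E2 : (#|F|.-1 = #|F|.-1./2 * 2)%N by move: card_gt1 oddF; lia.
by rewrite {1}E2 exprM => /eqP; rewrite sqrf_eq1 (negbTE y1) orbF => /eqP.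
Qed.

(** A generator [g] of the unit group works: from [x^2 = g] one would get
    [g^((q-1)/2) = x^(q-1) = 1], against the order of [g]. *)
Lemma finfield_nonsquare : exists d : F, forall x, x ^+ 2 != d.
Proof.
have [g Hg] := primitive_element; exists g => x; apply/negP => /eqP xg.
have x0 : x != 0.
  apply/eqP => x0; have := prim_expr_order Hg.
  rewrite -xg x0 !expr0n /= eqn0Ngt (prim_order_gt0 Hg) /= => /esym/eqP.
  by rewrite oner_eq0.
have : (#|F|.-1 %| #|F|.-1./2)%N.
  rewrite (prim_order_dvd Hg) -xg -exprM.
  have -> : (2 * #|F|.-1./2 = #|F|.-1)%N.
    by move: card_gt1 oddF; lia.
  apply/eqP; apply: (mulfI x0); rewrite -exprS prednK ?expf_card ?mulr1 //.
  by move: card_gt1; lia.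
by move/dvdn_leq; move: card_gt1 oddF; lia.
Qed.

Lemma quadratic_extension : exists (L : finFieldType) (j : {rmorphism F -> L}), #|L| = (#|F| ^ 2)%N.
Proof.
have [d nsq] := finfield_nonsquare.
pose h : {poly F} := 'X^2 - d%:P.
have szh : size h = 3 by rewrite size_XnsubC.
have hI : monic_irreducible_poly h.
  split; last by rewrite monicXnsubC.
  apply: cubic_irreducible => [|x]; first by rewrite szh.
  by rewrite /root !hornerE subr_eq0 nsq.
exists {poly %/ h with hI}, (qfpoly_const hI).
by rewrite card_qfpoly szh.
Qed.

End OddFiniteField.

(** * Trace and norm of a quadratic extension, and their effect on Kloosterman sums *)

Section QuadraticStep.
Variables (F L : finFieldType) (j : {rmorphism F -> L}).
Hypotheses (oddF : odd #|F|) (cardL : #|L| = (#|F| ^ 2)%N).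
Local Notation q := #|F|.

Let q_gt1 : (1 < q)%N := finNzRing_gt1 F.

(** The polynomial ['X^q - 'X] has at most [q] roots, and the image of [F] already provides [q] of
    them. *)
Lemma frobenius_descent (y : L) : y ^+ q = y -> exists t, j t = y.
Proof.
move=> yq; pose P : {poly L} := 'X^q - 'X.
have szP : size P = q.+1 by rewrite size_polyDl ?size_polyXn // size_polyN size_polyX.
have P0 : P != 0 by rewrite -size_poly_gt0 szP.
case: (pickP [pred t | j t == y]) => [t /eqP Et|ny]; first by exists t.
have rP z : root P z = (z ^+ q == z) by rewrite /root !hornerE subr_eq0.
suff : (size (y :: [seq j t | t <- enum F]) < size P)%N.
  by rewrite /= size_map -cardE szP ltnn.
apply: max_poly_roots => //.
  rewrite /= rP yq eqxx; apply/allP => z /mapP[t _ ->].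
  by rewrite rP -rmorphXn /= expf_card.
rewrite /= map_inj_uniq ?enum_uniq ?andbT; last exact: fmorph_inj.
by apply/mapP => -[t _ Et]; have := ny t; rewrite /= Et eqxx.
Qed.

Variables (p : nat).
Hypotheses (chp : p \in [pchar L]) (pq : p.-nat q).

Let frobD (x y : L) : (x + y) ^+ q = x ^+ q + y ^+ q.
Proof. by apply: exprDn_pchar; rewrite (eq_pnat _ (pcharf_eq chp)). Qed.

Let frobq (x : L) : (x ^+ q) ^+ q = x.
Proof. by rewrite -exprM mulnn -cardL expf_card. Qed.

Let frobj (t : F) : j t ^+ q = j t.
Proof. by rewrite -rmorphXn /= expf_card. Qed.

(** The preimage under [j] of a Frobenius-invariant element; by [frobenius_descent] it exists, so
    the default [0] is never reached. The same holds for [ext_norm]. *)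
Definition ext_trace (x : L) : F := odflt 0 [pick t | j t == x + x ^+ q].
Definition ext_norm (x : L) : F := odflt 0 [pick t | j t == x * x ^+ q].

Lemma ext_traceE x : j (ext_trace x) = x + x ^+ q.
Proof.
rewrite /ext_trace; case: pickP => [t /eqP //|nt].
have [t Et] : exists t, j t = x + x ^+ q.
  by apply: frobenius_descent; rewrite frobD frobq addrC.
by have := nt t; rewrite Et eqxx.
Qed.

Lemma ext_normE x : j (ext_norm x) = x * x ^+ q.
Proof.
rewrite /ext_norm; case: pickP => [t /eqP //|nt].
have [t Et] : exists t, j t = x * x ^+ q.
  by apply: frobenius_descent; rewrite exprMn frobq mulrC.
by have := nt t; rewrite Et eqxx.
Qed.

Let two_neq0 : 2%:R != 0 :> L.
Proof.
rewrite -(dvdn_pcharf chp) dvdn_prime2 ?(pcharf_prime chp) //.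
apply/negP => /eqP p2; have := pq; rewrite p2 => /p_natP[k Ek].
by move: oddF q_gt1; rewrite Ek; case: k {Ek} => // k; rewrite oddX.
Qed.

(** Euler's criterion in [L]: the exponent [(q^2 - 1)/2] is [(q - 1)] times [(q + 1)/2], and a
    nonzero [t] in [F] already satisfies [t^(q-1) = 1]. *)
Lemma ext_sqrt (t : F) : exists w : L, w ^+ 2 = j t.
Proof.
have [->|t0] := eqVneq t 0; first by exists 0; rewrite rmorph0 expr0n.
apply: finfield_square; first by rewrite cardL oddX oddF orbT.
have -> : (#|L|.-1./2 = q.-1 * (q.+1)./2)%N.
  rewrite cardL -mulnn; have [m ->] : exists m, q = m.*2.+1.
    by exists q./2; move: oddF; lia.
  have -> : ((m.*2.+1 * m.*2.+1).-1 = (m.*2 * m.+1).*2)%N by lia.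
  by rewrite doubleK /= doubleK.
rewrite exprM.
have -> : j t ^+ q.-1 = 1; last by rewrite expr1n.
have jt0 : j t != 0 by rewrite fmorph_eq0.
by apply: (mulfI jt0); rewrite -exprS prednK ?frobj ?mulr1 // ltnW.
Qed.

(* Both counts are numbers of roots in L of X^2 - s X + n: those fixed by Frobenius,
   and those which Frobenius sends to the other root. *)
Lemma card_sum_prod_fibers (s n : F) :
  (#|[pred z : F * F | ((z.1 + z.2, z.1 * z.2) == (s, n))%R]| +
   #|[pred x : L | (ext_trace x, ext_norm x) == (s, n)]| = 2)%N.
Proof.
have [w Ew] := ext_sqrt (s ^+ 2 - n *+ 4).
pose x1 := (j s + w) / 2%:R; pose x2 := (j s - w) / 2%:R.
have four_neq0 : 4%:R != 0 :> L by rewrite (natrM L 2 2) mulf_neq0.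
have x12 : x1 + x2 = j s by rewrite /x1 /x2; field.
have x12m : x1 * x2 = j n.
  have -> : x1 * x2 = (j s ^+ 2 - w ^+ 2) / 4%:R.
    by rewrite /x1 /x2; field; rewrite ?two_neq0 ?four_neq0.
  rewrite Ew rmorphB rmorphXn rmorphMn /= -mulr_natr.
  by field; rewrite ?two_neq0 ?four_neq0.
pose X := [set x1; x2].
have inX x : (x \in X) = (x * (j s - x) == j n).
  rewrite !inE -x12 -x12m -subr_eq0 -[RHS]subr_eq0.
  have -> : x * (x1 + x2 - x) - x1 * x2 = - ((x - x1) * (x - x2)) by ring.
  by rewrite oppr_eq0 mulf_eq0 [in RHS]subr_eq0 [x - x2 == 0]subr_eq0 subr_eq0.
have frobB (a b : L) : (a - b) ^+ q = a ^+ q - b ^+ q.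
  by apply/eqP; rewrite -subr_eq opprK -frobD subrK.
have Xq x : x \in X -> x ^+ q = x \/ x ^+ q = j s - x.
  rewrite inX => /eqP xX; have xqX : x ^+ q * (j s - x ^+ q) = j n.
    by rewrite -[in LHS](frobj s) -frobB -exprMn xX frobj.
  have /eqP : (x ^+ q - x) * (x ^+ q - (j s - x)) = 0.
    have -> : (x ^+ q - x) * (x ^+ q - (j s - x)) =
      x * (j s - x) - x ^+ q * (j s - x ^+ q) by ring.
    by rewrite xX xqX subrr.
  by rewrite mulf_eq0 !subr_eq0 => /orP[] /eqP; [left|right].
pose A := [set x in X | x ^+ q == x].
pose B := [set x in X | x ^+ q == j s - x].
have -> : #|[pred z : F * F | (z.1 + z.2, z.1 * z.2) == (s, n)]| = #|A|.
  rewrite -(@card_in_imset _ _ (fun z : F * F => j z.1)); last first.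
    move=> [a b] [a' b']; rewrite !inE !xpair_eqE /= => /andP[/eqP e1 _] /andP[/eqP e2 _].
    by move/fmorph_inj => E; rewrite -E in e2 *; rewrite -e2 in e1; move/addrI: e1 => ->; rewrite E.
  apply: eq_card => x; apply/imsetP/idP => [[[a b]]|].
    rewrite !inE xpair_eqE /= => /andP[/eqP Es /eqP En] ->.
    rewrite -(in_set2 (j a) x1 x2) -/X inX frobj eqxx andbT.
    by rewrite -Es -En rmorphD rmorphM /= [j a + _]addrC addrK.
  rewrite inE inX => /andP[/eqP Ex /eqP xq].
  have [a Ea] := frobenius_descent xq; exists (a, s - a); last by [].
  rewrite !inE xpair_eqE /= addrC subrK eqxx /=.
  by apply/eqP/(fmorph_inj j); rewrite rmorphM rmorphB /= Ea.
have -> : #|[pred x : L | (ext_trace x, ext_norm x) == (s, n)]| = #|B|.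
  apply: eq_card => x; rewrite !inE -(in_set2 x x1 x2) -/X inX xpair_eqE.
  rewrite -2!(inj_eq (fmorph_inj j)) ext_traceE ext_normE.
  have -> : (x + x ^+ q == j s) = (x ^+ q == j s - x) 
    by rewrite [RHS]eq_sym subr_eq [RHS]eq_sym addrC.
  by rewrite [RHS]andbC; case: (x ^+ q =P j s - x) => [->|].
have inA x : (x \in A) = (x \in X) && (x ^+ q == x) by rewrite in_set.
have inB x : (x \in B) = (x \in X) && (x ^+ q == j s - x) by rewrite in_set.
have UX : A :|: B = X.
  apply/setP => x; rewrite in_setU inA inB -andb_orr; case xX: (x \in X) => //=.
  by have [->|->] := Xq x xX; rewrite eqxx ?orbT.
(* [A] and [B] cover [X] and meet exactly when [x1] is a double root, so [#|A| + #|B|] is [1 + 1]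
   for a double root and [2 + 0] otherwise. *)
rewrite -cardsUI UX.
have [Ex|nx] := eqVneq x1 x2.
  have X1 : X = [set x1] by rewrite /X -Ex setUid.
  have js : j s - x1 = x1 by rewrite -x12 -Ex addrK.
  have -> : A :&: B = X; last by rewrite X1 cards1.
  apply/setP => x; rewrite in_setI inA inB; case xX: (x \in X) => //=.
  move: (xX); rewrite X1 inE => /eqP Exx; rewrite -Exx in js.
  by rewrite js andbb; have [->|->] := Xq x xX; rewrite ?js eqxx.
have -> : A :&: B = set0; last by rewrite cards0 cards2 nx.
apply/setP => x; rewrite in_setI inA inB in_set0; case xX: (x \in X) => //=.
apply/andP => -[/eqP -> /eqP E]; move: xX nx; rewrite !inE => /orP[] /eqP Exx.
  by rewrite -x12 Exx [x1 + x2]addrC addrK in E; rewrite E eqxx.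
by rewrite -x12 Exx addrK in E; rewrite E eqxx.
Qed.

End QuadraticStep.

Lemma sum_fibers (I J : finType) (V : nmodType) (f : I -> J) (P : pred J) (phi : J -> V) :
  \sum_(i | P (f i)) phi (f i) = \sum_(w | P w) phi w *+ #|[pred i | f i == w]|.
Proof.
rewrite (partition_big f P) //=; apply: eq_bigr => w Pw.
rewrite (eq_big (fun i => i \in [pred i | f i == w]) (fun=> phi w)).
- by rewrite sumr_const.
- by move=> i; rewrite !inE; case: eqP => [->|]; rewrite ?Pw ?andbF.
- by move=> i /andP[_ /eqP ->].
Qed.

(** The sum over [L] and the square of the sum over [F] are both sums of [chi (s + c s / n)],
    weighted by the number of elements with trace [s] and norm [n], respectively of pairs with sum
    [s] and product [n]. By [card_sum_prod_fibers] the weights add up to 2; the unweighted sum over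
    [s] vanishes unless [n = - c], where it is [q]. *)
Lemma kloosterman_quadratic (F L : finFieldType) (j : {rmorphism F -> L}) (p : nat)
    (chi : F -> algC) (a c : F) :
  odd #|F| -> #|L| = (#|F| ^ 2)%N -> p \in [pchar L] -> p.-nat #|F| ->
  addchar chi -> chi a != 1 -> c != 0 ->
  kloosterman (chi \o ext_trace j) (j c) = 2%:R * #|F|%:R - kloosterman chi c ^+ 2.
Proof.
move=> oddF cardL chp pq chiP ca c0; have [chiD _] := chiP.
pose phi (w : F * F) := chi (w.1 + c * w.1 / w.2).
have frobD (x y : L) : (x + y) ^+ #|F| = x ^+ #|F| + y ^+ #|F|.
  by apply: exprDn_pchar; rewrite (eq_pnat _ (pcharf_eq chp)).
have trE := ext_traceE j cardL chp pq; have nmE := ext_normE j cardL.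
have F0 : (0 < #|F|)%N := ltnW (finNzRing_gt1 F).
have nm0 (x : L) : (ext_norm j x != 0) = (x != 0).
  by rewrite -(fmorph_eq0 j) nmE mulf_eq0 expf_eq0 F0 orbb.
have EL : kloosterman (chi \o ext_trace j) (j c) =
  \sum_(w : F * F | w.2 != 0) phi w *+ #|[pred x : L | (ext_trace j x, ext_norm j x) == w]|.
  rewrite -(sum_fibers (fun x => (ext_trace j x, ext_norm j x)) (fun w : F * F => w.2 != 0) phi) /=.
  rewrite /kloosterman; apply: eq_big => [x|x x0]; first by rewrite nm0.
  rewrite /phi /=; congr chi; apply: (fmorph_inj j).
  rewrite trE rmorphD fmorph_div rmorphM /= trE nmE frobD exprMn exprVn -rmorphXn /= expf_card.
  have xq0 : x ^+ #|F| != 0 by rewrite expf_neq0.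
  by field; rewrite x0 xq0.
have EF : kloosterman chi c ^+ 2 =
  \sum_(w : F * F | w.2 != 0) phi w *+ #|[pred z : F * F | (z.1 + z.2, z.1 * z.2)%R == w]|.
  rewrite -(sum_fibers (fun z => (z.1 + z.2, z.1 * z.2)) (fun w : F * F => w.2 != 0) phi) /=.
  rewrite expr2 /kloosterman big_distrlr /=.
  rewrite pair_big /=; apply: eq_big => [[x y]|[x y]] /=; first by rewrite mulf_eq0 negb_or.
  case/andP => x0 y0; rewrite -chiD /phi /=; congr chi.
  by field; rewrite x0 y0.
apply/eqP; rewrite eq_sym subr_eq EL EF -big_split /=; apply/eqP.
transitivity (\sum_(w : F * F | w.2 != 0) phi w *+ 2); last first.
  apply: eq_bigr => -[s n] _; rewrite -mulrnDr addnC; congr (_ *+ _).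
  by rewrite -(card_sum_prod_fibers j oddF cardL chp pq s n).
rewrite sumrMnl -(pair_big xpredT (fun n => n != 0) (fun s n => phi (s, n))) exchange_big /=.
rewrite (bigD1 (- c)) ?oppr_eq0 //= [X in _ + X]big1 ?addr0 => [|n /andP[n0 nc]].
  under eq_bigr => s _ do rewrite /phi /= invrN mulrN mulrAC divff // mul1r subrr (addchar0 chiP).
  by rewrite sumr_const mulr_natl.
transitivity (\sum_s chi (s * (1 + c / n))).
  by apply: eq_bigr => s _; rewrite /phi /=; congr chi; field.
rewrite (sum_addchar_scaled _ chiP ca) ifF //; apply/negbTE.
have -> : 1 + c / n = (n + c) / n by field.
by rewrite mulf_neq0 ?invr_eq0 // addr_eq0.
Qed.

(** The Kloosterman sum over the field with [p^(2^k)] elements, predicted from its value [K] over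
    ['F_p]. *)
Fixpoint kloosterman_seq (p : nat) (K : algC) (k : nat) : algC :=
  if k is k'.+1 then 2%:R * (p ^ 2 ^ k')%:R - kloosterman_seq p K k' ^+ 2 else K.

(* T plays the role of the trace from L down to F_p. *)
Lemma kloosterman_tower (p k : nat) : prime p -> odd p ->
  exists (L : finFieldType) (j : {rmorphism 'F_p -> L}) (T : L -> 'F_p),
    [/\ #|L| = (p ^ 2 ^ k)%N, (forall x y, T (x + y) = T x + T y),
        (forall x, T (x ^+ p) = T x), (exists x, T x != 0) &
        forall (chi : 'F_p -> algC) (a c : 'F_p), addchar chi -> chi a != 1 -> c != 0 ->
          addchar (chi \o T) /\
          kloosterman (chi \o T) (j c) = kloosterman_seq p (kloosterman chi c) k].
Proof.
move=> pr_p odd_p; elim: k => [|k [F [j [T [cardF TD Tp [x0 Tx0] IH]]]]].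
  exists 'F_p, idfun, id; split=> //.
  - by rewrite card_Fp // expn0 expn1.
  - by move=> x; have := expf_card x; rewrite card_Fp.
  - by exists 1; rewrite oner_eq0.
have oddF : odd #|F| by rewrite cardF oddX odd_p orbT.
have [L [i cardL]] := quadratic_extension oddF.
have chp : p \in [pchar L].
  have := pchar_Fp pr_p.
  move=> H; rewrite (fmorph_pchar i) (fmorph_pchar j).
  exact: H.
have pq : p.-nat #|F| by rewrite cardF pnatX pnat_id.
have trE := ext_traceE i cardL chp pq.
have frobD (x y : L) : (x + y) ^+ #|F| = x ^+ #|F| + y ^+ #|F|.
  by apply: exprDn_pchar; rewrite (eq_pnat _ (pcharf_eq chp)).
have T0 : T 0 = 0 by apply: (addrI (T 0)); rewrite -TD !addr0.
have Tn x n : T (x *+ n) = T x *+ n.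
  by elim: n => [|n IHn]; rewrite ?mulr0n // !mulrS TD IHn.
have Tnt (chi : 'F_p -> algC) a : chi a != 1 -> exists y, chi (T y) != 1.
  move=> ca; exists (x0 *+ (a / T x0)%R); rewrite Tn -mulr_natl natr_Zp.
  by rewrite divfK.
exists L, (i \o j), (T \o ext_trace i); split.
- by rewrite cardL cardF -expnM -expnSr.
- move=> x y /=; rewrite -TD; congr T; apply: (fmorph_inj i).
  by rewrite rmorphD /= !trE frobD addrACA.
- move=> x /=; rewrite -[RHS]Tp; congr T; apply: (fmorph_inj i).
  rewrite trE rmorphXn /= trE exprDn_pchar -?exprM 1?mulnC //.
  by rewrite (eq_pnat _ (pcharf_eq chp)) pnat_id.
- exists (i x0) => /=.
  have -> : ext_trace i (i x0) = x0 *+ 2.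
    by apply: (fmorph_inj i); rewrite trE -rmorphXn /= expf_card mulr2n rmorphD.
  rewrite Tn -mulr_natl mulf_neq0 //.
  rewrite -(dvdn_pcharf (pchar_Fp pr_p)) dvdn_prime2 //.
  by apply: contraL odd_p => /eqP ->.
move=> chi a c chiP ca c0.
have [chiTP E] := IH chi a c chiP ca c0.
have [y cy] := Tnt chi a ca.
split.
  split=> [x z|x] /=; last by rewrite chiP.2.
  rewrite -chiP.1 -TD; congr (chi (T _)); apply: (fmorph_inj i).
  by rewrite rmorphD /= !trE frobD addrACA.
rewrite /= -E -cardF.
rewrite -(@kloosterman_quadratic F L i p (chi \o T) y (j c)) //.
by rewrite fmorph_eq0.
Qed.

(** * Point counts on [y^p - y = x + c/x] and Weil's bound *)

Lemma card_artin_schreier_fiber (L : finFieldType) (p : nat) (t : L) : (1 < p)%N ->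
  (#|[pred y : L | (t == y ^+ p - y)%R]| <= p)%N.
Proof.
move=> p1; pose P : {poly L} := 'X^p - 'X - t%:P.
have szP : size P = p.+1.
  have sz1 : size ('X^p - 'X : {poly L}) = p.+1.
    by rewrite size_polyDl size_polyXn // size_polyN size_polyX.
  by rewrite /P size_polyDl sz1 // size_polyN (leq_ltn_trans (size_polyC_leq1 _)) // ltnS ltnW.
rewrite -ltnS -szP cardE; apply: max_poly_roots; rewrite ?enum_uniq //.
  by rewrite -size_poly_gt0 szP.
apply/allP => y; rewrite mem_enum inE => /eqP ty.
by rewrite /root !hornerE ty subrr.
Qed.

Lemma card_artin_schreier_sq_roots (L : finFieldType) (p : nat) (c : L) :
  p \in [pchar L] -> odd p -> c != 0 ->
  (#|[pred y : L | ((y ^+ p - y) ^+ 2 - c == 0)%R]| <= 2 * p)%N.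
Proof.
move=> chp odd_p c0; pose P : {poly L} := ('X^p - 'X) ^+ 2 - c%:P.
have szP : (size P <= (2 * p).+1)%N := size_artin_schreier_sq c chp.
have P0 : P != 0.
  apply/eqP => P0; have := @artin_schreier_sq_nonsquare L p c chp odd_p c0 0 1.
  rewrite -/P P0 mul0r expr0n => /(_ erefl)/eqP; by rewrite oner_eq0.
rewrite -ltnS cardE; apply: leq_trans szP; apply: max_poly_roots; rewrite ?enum_uniq //.
apply/allP => y; rewrite mem_enum inE => /eqP ty.
by rewrite /root /P !hornerE ty.
Qed.

(** Points of [y^p - y = x + c/x] are counted in two ways. Over a given [y] the equation is
    quadratic in [x] with discriminant [g y], a nonzero square outside [bad] and [zer], which gives
    two points. Over a given [x] there are at most [p] points, and none unless [T (x + c/x) = 0],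
    because [T] kills [y^p - y]. *)
Lemma trace_zero_count (L : finFieldType) (p Q h : nat) (c : L) (V : zmodType) (T : L -> V) :
  p \in [pchar L] -> odd p -> c != 0 -> (forall x y, T (x + y) = T x + T y) ->
  (forall x, T (x ^+ p) = T x) ->
  p.-nat Q -> Q = h.*2.+1 -> (p < h)%N -> #|L| = (Q ^ 2)%N ->
  (Q ^ 2 <= p * #|[pred x : L | ((x != 0) && (T (x + c / x) == 0))%R]| + (2 * p * Q + 4 * p))%N.
Proof.
move=> chp odd_p c0 TD Tp pQ Qh ph cardL.
have pr_p : prime p := pcharf_prime chp.
have p1 := prime_gt1 pr_p.
have two0 := two_neq0_pchar chp odd_p.
have four0 : 4%:R != 0 :> L by rewrite (natrM L 2 2) mulf_neq0.
pose c4 := 4%:R * c; have c40 : c4 != 0 by rewrite mulf_neq0.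
pose g y := (y ^+ p - y) ^+ 2 - c4.
pose R x y := (x != 0) && (x + c / x == y ^+ p - y).
pose bad := [set y : L | g y ^+ (Q ^ 2).-1./2 == -1].
pose zer := [set y : L | g y == 0].
have Hbad : (2 * #|bad| <= Q ^ 2 + 2 * p * Q)%N :=
  stepanov_nonsquare_count chp odd_p c40 pQ Qh ph cardL.
have Hzer : (#|zer| <= 2 * p)%N.
  by apply: leq_trans (card_artin_schreier_sq_roots chp odd_p c40); rewrite cardsE.
have oddL : odd #|L| by rewrite cardL oddX Qh /= odd_double.
have lower y : y \in ~: (bad :|: zer) -> (2 <= \sum_(x | R x y) 1)%N.
  rewrite !inE negb_or => /andP[nb nz].
  have [w Ew] : exists w, w ^+ 2 = g y by apply: finfield_euler => //; rewrite cardL.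
  have w0 : w != 0 by apply: contraNneq nz => w0; rewrite -Ew w0 expr0n.
  pose u := y ^+ p - y; pose x1 := (u + w) / 2%:R; pose x2 := (u - w) / 2%:R.
  have x12m : x1 * x2 = c.
    have -> : x1 * x2 = (u ^+ 2 - w ^+ 2) / 4%:R by rewrite /x1 /x2; field; rewrite ?two0 ?four0.
    by rewrite Ew /g /c4 -/u; field; rewrite ?four0.
  have x12 : x1 + x2 = u by rewrite /x1 /x2; field.
  have x10 : x1 != 0 by apply: contraNneq c0 => E; rewrite -x12m E mul0r.
  have x20 : x2 != 0 by apply: contraNneq c0 => E; rewrite -x12m E mulr0.
  rewrite sum1dep_card.
  have <- : #|[set x1; x2]| = 2%N.
    rewrite cards2; case: eqVneq => // E.
    have : x1 - x2 = w by rewrite /x1 /x2; field.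
    by rewrite E subrr => /esym w00; rewrite w00 eqxx in w0.
  apply/subset_leq_card/subsetP => x; rewrite !inE /R -/u -x12 -x12m.
  case/orP => /eqP ->; rewrite ?x10 ?x20 /=; apply/eqP; first by rewrite mulrAC divff ?mul1r.
  by rewrite mulfK // addrC.
have upper x : (\sum_(y | R x y) 1 <= p * ((x != 0) && (T (x + c / x) == 0))%R)%N.
  rewrite sum1dep_card; have [->|x0 /=] := eqVneq x 0.
    by rewrite eq_card0 // => y; rewrite inE /R eqxx.
  case: eqP => [_|nT]; rewrite /= ?muln1 ?muln0.
    apply: leq_trans (card_artin_schreier_fiber (x + c / x) p1).
    by apply/subset_leq_card/subsetP => y; rewrite !inE => /andP[_].
  rewrite leqn0; apply/eqP/eq_card0 => y; rewrite inE /R x0 /=; apply/eqP => E; apply: nT.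
  apply: (addIr (T y)); rewrite add0r E -TD subrK; exact: Tp.
have H1 : (2 * #|~: (bad :|: zer)| <= \sum_(y : L) \sum_(x | R x y) 1)%N.
  rewrite mulnC -sum_nat_const [X in (_ <= X)%N](bigID (fun y => y \in ~: (bad :|: zer))) /=.
  exact: leq_trans (leq_sum _ lower) (leq_addr _ _).
have H2 : (\sum_(y : L) \sum_(x | R x y) 1 <= p * #|[pred x : L | ((x != 0) && (T (x + c / x) == 0))%R]|)%N.
  rewrite (exchange_big_dep xpredT) //= -sum1_card big_distrr /= [X in (_ <= X)%N]big_mkcond /=.
  apply: leq_sum => x _; apply: leq_trans (upper x) _.
  by rewrite inE; case: ((x != 0) && _); rewrite ?muln1 ?muln0.
have H3 : (#|bad :|: zer| + #|~: (bad :|: zer)| = Q ^ 2)%N by rewrite cardsC cardL.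
have H4 : (#|bad :|: zer| <= #|bad| + #|zer|)%N by rewrite cardsU leq_subr.
move: (Q ^ 2)%N (2 * p * Q)%N H1 H2 H3 H4 Hbad Hzer => q2 pq.
set X := (p * _)%N; lia.
Qed.

Lemma kloosterman_seq_real p K k : K \is Num.real -> kloosterman_seq p K k \is Num.real.
Proof.
move=> Kr; elim: k => //= k IH.
by rewrite rpredB ?rpredX // rpredM ?realn.
Qed.

Lemma kloosterman_seq_le p K k : K \is Num.real ->
  kloosterman_seq p K k.+1 <= 2%:R * (p ^ 2 ^ k)%:R.
Proof.
move=> Kr /=; rewrite lerBlDr lerDl real_exprn_even_ge0 //.
exact: kloosterman_seq_real.
Qed.

(* The sum of the Kloosterman sums of all characters x -> chi (b x) counts the zeros of
   T (x + c / x), and each of the other terms is at most 2 p^(2^(k+1)). *)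
Lemma kloosterman_seq_ge (p k : nat) (chi : 'F_p -> algC) (a c : 'F_p) :
  prime p -> odd p -> addchar chi -> chi a != 1 -> c != 0 ->
  - (8 * p * p ^ 2 ^ k.+1)%:R <= kloosterman_seq p (kloosterman chi c) k.+2.
Proof.
move=> pr_p odd_p chiP ca c0.
have p1 := prime_gt1 pr_p.
pose Q := (p ^ 2 ^ k.+1)%N; pose h := (Q./2)%N.
have [L [j [T [cardL TD Tp _ HT]]]] := kloosterman_tower k.+2 pr_p odd_p.
have Q2 : #|L| = (Q ^ 2)%N by rewrite cardL /Q -expnM -expnSr.
have chp : p \in [pchar L] by rewrite (fmorph_pchar j); exact: pchar_Fp.
have Qh : Q = h.*2.+1 by rewrite /h -[LHS]odd_double_half /Q oddX odd_p orbT.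
have Qge : (p ^ 2 <= Q)%N by rewrite leq_exp2l // expnS leq_pmulr // expn_gt0.
have ph : (p < h)%N.
  have : (3 <= p)%N by rewrite ltn_neqAle p1 andbT; apply: contraTneq odd_p => <-.
  by move: Qge; rewrite Qh -mulnn; nia.
have jc0 : j c != 0 by rewrite fmorph_eq0.
have pQ : p.-nat Q by rewrite pnatX pnat_id.
have := trace_zero_count chp odd_p jc0 TD Tp pQ Qh ph Q2.
set N := #|_| => count.
pose chib (b x : 'F_p) := chi (b * x).
have chibP b : addchar (chib b).
  by split=> [x y|x]; rewrite /chib ?mulrDr ?chiP.1 ?chiP.2.
have klob b : b != 0 ->
    kloosterman (chib b \o T) (j c) = kloosterman_seq p (kloosterman (chib b) c) k.+2.
  move=> b0; have cb : chib b (a / b) != 1 by rewrite /chib mulrC divfK.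
  by have [] := HT _ _ _ (chibP b) cb c0.
have klo1 : kloosterman (chib 1) c = kloosterman chi c.
  by apply: eq_bigr => x _; rewrite /chib mul1r.
have Qgt0 : (0 < Q)%N by rewrite Qh.
have klo0 : kloosterman (chib 0 \o T) (j c) = (Q ^ 2).-1%:R.
  rewrite /kloosterman (eq_bigr (fun=> 1)); last first.
    by move=> x _; rewrite /= /chib mul0r (addchar0 chiP).
  by rewrite sumr_const -Q2 -(cardC1 (0 : L)).
have E : \sum_(b : 'F_p) kloosterman (chib b \o T) (j c) = (p * N)%:R.
  rewrite /kloosterman exchange_big /= natrM /N -sum1_card natr_sum mulr_sumr.
  rewrite [RHS]big_mkcond [LHS]big_mkcond; apply: eq_bigr => x _; rewrite inE /chib.
  have [//|x0 /=] := eqVneq x 0.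
  by rewrite (sum_addchar_scaled _ chiP ca) card_Fp // mulr1.
(* The term [b = 0] is [Q^2 - 1], the term [b = 1] is the sum to be bounded below, and the remaining
   ones are at most [2Q] each. *)
have : (p * N)%:R <= (Q ^ 2).-1%:R + (kloosterman_seq p (kloosterman chi c) k.+2 + p%:R * (2%:R * Q%:R)).
  rewrite -E (bigD1 0) //= klo0 lerD2l (bigD1 1) ?oner_eq0 //= klob ?oner_eq0 // klo1 lerD2l.
  apply: (@le_trans _ _ (\sum_(b : 'F_p | (b != 0) && (b != 1)) (2%:R * Q%:R))).
    apply: ler_sum => b /andP[b0 _]; rewrite klob //.
    by apply: kloosterman_seq_le; apply: kloosterman_real.
  rewrite sumr_const [X in _ <= X]mulr_natl ler_wpMn2l ?mulr_ge0 ?ler0n //.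
  by rewrite -[X in (_ <= X)%N](card_Fp pr_p) max_card.
move=> H.
have : (Q ^ 2)%:R <= (Q ^ 2).-1%:R + (kloosterman_seq p (kloosterman chi c) k.+2 + p%:R * (2%:R * Q%:R))
   + (2 * p * Q + 4 * p)%:R :> algC.
  apply: (@le_trans _ _ (p * N + (2 * p * Q + 4 * p))%:R); first by rewrite ler_nat.
  by rewrite natrD lerD2r.
rewrite -/Q; set K := kloosterman_seq _ _ _ => {}H.
have A : ((Q ^ 2).-1 + p * (2 * Q) + (2 * p * Q + 4 * p) <= Q ^ 2 + 8 * p * Q)%N.
  have : (0 < Q ^ 2)%N by rewrite expn_gt0 Qgt0.
  by move: (Q ^ 2)%N => q2 q20; have : (p <= p * Q)%N := leq_pmulr _ Qgt0; lia.
have : (Q ^ 2)%:R <= K + (Q ^ 2 + 8 * p * Q)%:R.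
  apply: le_trans H _; apply: le_trans (_ : K + ((Q ^ 2).-1 + p * (2 * Q) + (2 * p * Q + 4 * p))%:R <= _).
    by rewrite le_eqVlt; apply/orP; left; apply/eqP; rewrite !natrD !natrM; ring.
  by rewrite lerD2l ler_nat.
by rewrite natrD addrCA lerDl -lerBlDr sub0r.
Qed.

(** Put [K^2 = (4 + e) p]. If [e > 0], the recursion [K' = 2q - K^2] makes the excess of [- K'/q]
    over 2 at least quadruple at every level from the value [e], whereas [kloosterman_seq_ge] keeps
    [- K'/q] below [8p]. *)
Theorem kloosterman_sqr_le (p : nat) (chi : 'F_p -> algC) (a c : 'F_p) :
  prime p -> odd p -> addchar chi -> chi a != 1 -> c != 0 ->
  kloosterman chi c ^+ 2 <= (4 * p)%:R.
Proof.
move=> pr_p odd_p chiP ca c0.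
have p0 : 0 < p%:R :> algC by rewrite ltr0n prime_gt0.
set K := kloosterman chi c; have Kr : K \is Num.real := kloosterman_real c chiP.
have [//|bad] := real_leP (rpredX 2 Kr) (realn _ (4 * p)).
pose e := (K ^+ 2 - (4 * p)%:R) / p%:R.
have e0 : 0 < e by rewrite divr_gt0 // subr_gt0.
have grow k : (2%:R + 4%:R ^+ k * e) * (p ^ 2 ^ k)%:R <= - kloosterman_seq p K k.+1.
  elim: k => [|k IH].
    rewrite /= expn0 expn1 expr0 mul1r /e natrM le_eqVlt; apply/orP; left; apply/eqP.
    by field; rewrite gt_eqF.
  have E0 : 0 <= 4%:R ^+ k * e by rewrite mulr_ge0 ?exprn_ge0 ?ler0n // ltW.
  have Q0 : 0 <= (p ^ 2 ^ k)%:R :> algC by rewrite ler0n.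
  rewrite [kloosterman_seq _ _ _]/= -/(kloosterman_seq p K k.+1) opprB lerBrDr.
  rewrite -[X in _ <= X]sqrrN.
  have lhs0 : 0 <= (2%:R + 4%:R ^+ k * e) * (p ^ 2 ^ k)%:R.
    by rewrite mulr_ge0 // addr_ge0.
  apply: le_trans (_ : ((2%:R + 4%:R ^+ k * e) * (p ^ 2 ^ k)%:R) ^+ 2 <= _); last first.
    by rewrite lerXn2r ?nnegrE // (le_trans lhs0).
  rewrite [(2 ^ k.+1)%N]expnSr expnM natrX exprS.
  set E := 4%:R ^+ k * e in E0 *; set Q := (p ^ 2 ^ k)%:R in Q0 *.
  have -> : ((2%:R + E) * Q) ^+ 2 = (2%:R + 4%:R * 4%:R ^+ k * e) * Q ^+ 2 + 2%:R * Q ^+ 2 + (E * Q) ^+ 2.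
    by rewrite /E; ring.
  by rewrite lerDl exprn_ge0 // mulr_ge0.
have bound k : 4%:R ^+ k.+1 * e <= (8 * p)%:R.
  have Q0 : 0 < (p ^ 2 ^ k.+1)%:R :> algC by rewrite ltr0n expn_gt0 prime_gt0.
  have ub : - kloosterman_seq p K k.+2 <= (8 * p)%:R * (p ^ 2 ^ k.+1)%:R.
    by rewrite -natrM lerNl; apply: kloosterman_seq_ge ca c0.
  have := le_trans (grow k.+1) ub; rewrite ler_pM2r // => H.
  by apply: le_trans H; rewrite lerDr ler0n.
pose M := Num.bound ((8 * p)%:R / e).
have M1 : (8 * p)%:R / e < M%:R by apply: archi_boundP; rewrite divr_ge0 ?ler0n // ltW.
have M2 : (M <= 4 ^ M.+1)%N by apply: leq_trans (ltnW (ltn_expl M (isT : 1 < 4)%N)) _; rewrite leq_exp2l.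
have : 4%:R ^+ M.+1 <= (8 * p)%:R / e by rewrite ler_pdivlMr.
rewrite -natrX => /le_lt_trans/(_ M1); rewrite ltr_nat ltnNge M2 //.
Qed.

(** * Gauss and Salie sums, spheres over F_p *)

Section GaussSums.
Variables (p : nat) (chi : 'F_p -> algC) (a : 'F_p).
Hypotheses (pr_p : prime p) (odd_p : odd p) (chiP : addchar chi) (ca : chi a != 1).
Local Notation F := ('F_p).

Let cardF : #|F| = p := card_Fp pr_p.
Let chp : p \in [pchar F] := pchar_Fp pr_p.
Let two0 : 2%:R != 0 :> F. Proof. exact: two_neq0_pchar chp odd_p. Qed.
Let four0 : 4%:R != 0 :> F. Proof. by rewrite (natrM F 2 2) mulf_neq0. Qed.
Let oddF : odd #|F|. Proof. by rewrite cardF. Qed.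

Let sum_chi (t : F) : \sum_x chi (x * t) = if t == 0 then p%:R else 0.
Proof. by rewrite (sum_addchar_scaled _ chiP ca) cardF. Qed.

Let sum_chi_neq0 (t : F) : \sum_(x | x != 0) chi (x * t) = (if t == 0 then p%:R else 0) - 1.
Proof.
by rewrite -sum_chi [in RHS](bigD1 0) //= mul0r (addchar0 chiP) addrAC subrr add0r.
Qed.

Definition gauss (s : F) : algC := \sum_x chi (s * x ^+ 2).

Lemma gauss_linear (s u : F) : s != 0 ->
  \sum_x chi (s * x ^+ 2 + u * x) = gauss s * chi (- (u ^+ 2 / (4%:R * s))).
Proof.
move=> s0; rewrite (reindex_inj (addrI (- (u / (2%:R * s))))) /= /gauss mulr_suml.
apply: eq_bigr => x _; rewrite -chiP.1; congr chi.
by field; rewrite ?two0 ?four0 ?s0.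
Qed.

Lemma gauss_norm (s : F) : s != 0 -> `|gauss s| ^+ 2 = p%:R.
Proof.
move=> s0; rewrite normCK /gauss rmorph_sum big_distrlr /=.
rewrite exchange_big /=.
transitivity (\sum_y \sum_u chi (s * u ^+ 2 + y * (2%:R * s * u))).
  apply: eq_bigr => y _; rewrite (reindex_inj (addrI y)) /=; apply: eq_bigr => u _.
  by rewrite conj_addchar // -chiP.1; congr chi; ring.
rewrite exchange_big /= (bigD1 0) //= [X in _ + X]big1 ?addr0 => [|u u0].
  rewrite (eq_bigr (fun=> 1)) ?sumr_const ?cardF // => y _.
  by rewrite expr0n !mulr0 addr0 (addchar0 chiP).
under eq_bigr do rewrite chiP.1.
by rewrite -mulr_sumr sum_chi ifF ?mulr0 // !mulf_eq0 (negbTE two0) (negbTE s0) (negbTE u0).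
Qed.

Lemma gauss_square (r s : F) : r != 0 -> gauss (r ^+ 2 * s) = gauss s.
Proof.
move=> r0; rewrite /gauss [RHS](reindex_inj (mulfI r0)) /=.
by apply: eq_bigr => x _; congr chi; ring.
Qed.

Let card_sqrt (t : F) : (#|[pred x : F | (x ^+ 2 == t)%R]| <= 2)%N.
Proof.
pose P : {poly F} := 'X^2 - t%:P.
have szP : size P = 3%N by rewrite size_XnsubC.
rewrite -ltnS -szP cardE; apply: max_poly_roots; rewrite ?enum_uniq //.
  by rewrite -size_poly_gt0 szP.
by apply/allP => y; rewrite mem_enum inE => /eqP ty; rewrite /root !hornerE ty subrr.
Qed.

Let card_sqrt_square (w : F) : w != 0 -> #|[pred x : F | (x ^+ 2 == w ^+ 2)%R]| = 2%N.
Proof.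
move=> w0; rewrite (eq_card (B := [set w; - w])); last first.
  by move=> x; rewrite !inE eqf_sqr.
rewrite cards2; case: eqVneq => // E; move: (w0).
have : w *+ 2 = 0 by rewrite mulr2n {2}E subrr.
by move/eqP; rewrite -mulr_natr mulf_eq0 (negbTE two0) orbF => ->.
Qed.

(** Every [y] is hit exactly twice in all by [x^2] and [k x^2] together, so the two Gauss sums add
    up to twice a full character sum, which is zero. *)
Lemma gauss_nonsquare (k s : F) : (forall x, x ^+ 2 != k) -> s != 0 ->
  gauss (k * s) = - gauss s.
Proof.
move=> nk s0; apply/eqP; rewrite -addr_eq0 addrC; apply/eqP.
have k0 : k != 0 by have := nk 0; rewrite expr0n eq_sym.
have E (b : F) : gauss (b * s) = \sum_y chi (y * s) *+ #|[pred x | b * x ^+ 2 == y]|.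
  by rewrite -(@sum_fibers _ _ _ (fun x => b * x ^+ 2) xpredT) /gauss; apply: eq_bigr => x _; congr chi; ring.
rewrite -{1}[s]mul1r !E -big_split /=.
have cnt y : (#|[pred x : F | (1 * x ^+ 2 == y)%R]| + #|[pred x : F | (k * x ^+ 2 == y)%R]| = 2)%N.
  have -> : #|[pred x : F | (1 * x ^+ 2 == y)%R]| = #|[pred x : F | (x ^+ 2 == y)%R]|.
    by apply: eq_card => x; rewrite !inE mul1r.
  have -> : #|[pred x : F | (k * x ^+ 2 == y)%R]| = #|[pred x : F | (x ^+ 2 == y / k)%R]|.
    by apply: eq_card => x; rewrite !inE -[in RHS](inj_eq (mulfI k0)) [k * (y / k)]mulrC divfK.
  have [->|y0] := eqVneq y 0.
    rewrite mul0r (eq_card (B := pred1 0)) ?card1 // => x.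
    by rewrite !inE expf_eq0.
  have kh : k ^+ #|F|.-1./2 = -1.
    apply/eqP/negPn/negP => /(finfield_euler oddF k0)[w Ew].
    by have := nk w; rewrite Ew eqxx.
  have [yh|yh] := eqVneq (y ^+ #|F|.-1./2) (-1).
    have [w Ew] : exists w, w ^+ 2 = y / k.
      apply: finfield_square => //; rewrite exprMn exprVn yh kh invrN1 mulrNN mulr1 //.
    have w0 : w != 0 by apply: contraNneq y0 => w0; rewrite -[y](divfK k0) -Ew w0 expr0n mul0r.
    rewrite -Ew card_sqrt_square // eq_card0 // => x; rewrite inE; apply/negP => /eqP Ex.
    have := nk (x / w); rewrite exprMn exprVn Ew Ex invf_div mulrCA divff // mulr1 eqxx //.
  have [w Ew] := finfield_euler oddF y0 yh.
  have w0 : w != 0 by apply: contraNneq y0 => w0; rewrite -Ew w0 expr0n.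
  rewrite -Ew card_sqrt_square // eq_card0 ?addn0 // => x; rewrite inE; apply/negP => /eqP Ex.
  have x0 : x != 0.
    by apply: contraNneq y0 => x0; move/eqP: Ex; rewrite x0 expr0n eq_sym mulf_eq0 invr_eq0 (negbTE k0) orbF Ew.
  have := nk (w / x); rewrite exprMn exprVn Ex Ew invf_div mulrCA divff // mulr1 eqxx //.
rewrite (eq_bigr (fun y => chi (y * s) *+ 2)); last by move=> y _; rewrite -mulrnDr cnt.
by rewrite sumrMnl sum_chi (negbTE s0) mul0rn.
Qed.

Lemma gauss_sqr_const (s : F) : s != 0 -> gauss s ^+ 2 = gauss 1 ^+ 2.
Proof.
move=> s0; case: (pickP [pred r : F | r ^+ 2 == s]) => [r /eqP Er|ns].
  rewrite -Er -[r ^+ 2]mulr1 gauss_square //.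
  by apply: contraNneq s0 => r0; rewrite -Er r0 expr0n.
rewrite -[s]mulr1 gauss_nonsquare ?oner_eq0 ?sqrrN // => x.
by have := ns x; rewrite /= => ->.
Qed.

(** Opening the Gauss sum and undoing the completion of the square turns the phase into
    [x v + s (x^2 - t)]. Summing over [s] first leaves [p] times a sum over the at most two square
    roots of [t], minus a full character sum. *)
Lemma salie_square_le (v t : F) :
  `|\sum_(s | s != 0) gauss s * chi (- (s * t) - v ^+ 2 / (4%:R * s))| <= (2 * p)%:R.
Proof.
have -> : \sum_(s | s != 0) gauss s * chi (- (s * t) - v ^+ 2 / (4%:R * s)) =
  \sum_x chi (x * v) * ((if x ^+ 2 == t then p%:R else 0) - 1).
  transitivity (\sum_(s : F | s != 0) \sum_x chi (x * v) * chi (s * (x ^+ 2 - t))).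
    apply: eq_bigr => s s0; rewrite addrC chiP.1 mulrA -gauss_linear // mulr_suml.
    by apply: eq_bigr => x _; rewrite -!chiP.1; congr chi; ring.
  rewrite exchange_big /=; apply: eq_bigr => x _.
  by rewrite -mulr_sumr sum_chi_neq0 subr_eq0.
have c2 : #|[pred x : F | (x ^+ 2 == t)%R]|%:R <= 2%:R :> algC by rewrite ler_nat card_sqrt.
under eq_bigr do rewrite mulrBr mulr1.
rewrite sumrB sum_chi.
have -> : \sum_x chi (x * v) * (if x ^+ 2 == t then p%:R else 0) =
    p%:R * \sum_(x | x ^+ 2 == t) chi (x * v).
  rewrite mulr_sumr [RHS]big_mkcond; apply: eq_bigr => x _.
  by case: ifP => _; rewrite ?mulr0 // mulrC.
have [->|v0] := eqVneq v 0.
  rewrite (eq_bigr (fun=> 1)); last by move=> x _; rewrite mulr0 (addchar0 chiP).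
  rewrite sumr_const -[X in _ - X]mulr1 -mulrBr normrM natrM mulrC normr_nat ler_wpM2r ?ler0n //.
  rewrite real_ler_norml ?rpredB ?realn ?rpred1 //; apply/andP; split; last by rewrite lerBlDr (le_trans c2) // lerDl ler01.
  by rewrite lerBrDr (le_trans _ (ler0n _ _)) // addrC subr_le0 ler1n.
rewrite subr0 normrM normr_nat mulnC natrM ler_wpM2l ?ler0n //.
apply: le_trans (ler_norm_sum _ _ _) _; apply: le_trans c2.
by rewrite (eq_bigr (fun=> 1)) ?sumr_const // => x _; rewrite chiP.2.
Qed.

(* If M is not a square, exchanging s and M / (4 t s) when t is a square, or scaling s by M
   when it is not, changes the sign of the Gauss sum. *)
Lemma salie_le (M t : F) : t != 0 ->
  `|\sum_(s | s != 0) gauss s * chi (- (s * t) - M / (4%:R * s))| <= (2 * p)%:R.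
Proof.
move=> t0; case: (pickP [pred v : F | v ^+ 2 == M]) => [v /eqP <-|nM].
  exact: salie_square_le.
have {}nM v : v ^+ 2 != M by rewrite (negbT (nM v)).
have M0 : M != 0 by have := nM 0; rewrite expr0n eq_sym.
case: (pickP [pred v : F | v ^+ 2 == t]) => [w /eqP Ew|nt].
  set S := \sum_(_ | _) _; suff : S = - S.
    move/eqP; rewrite -addr_eq0 -mulr2n mulrn_eq0 /= => /eqP ->.
    by rewrite normr0 ler0n.
  have w0 : w != 0 by apply: contraNneq t0 => w0; rewrite -Ew w0 expr0n.
  have Kn0 : M / (4%:R * t) != 0 by rewrite mulf_neq0 ?invr_eq0 // mulf_neq0.
  have inj : {on [pred s | s != 0], bijective (fun s => M / (4%:R * t) / s)}.
    exists (fun s => M / (4%:R * t) / s) => s; rewrite inE => s0;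
     by rewrite invf_div mulrCA divff // mulr1.
  rewrite {1}/S (reindex _ inj) /= -sumrN; apply: eq_big => [s|s].
    by rewrite mulf_eq0 (negbTE Kn0) invr_eq0.
  rewrite mulf_eq0 (negbTE Kn0) invr_eq0 /= => s0; rewrite -[RHS]mulNr; congr (_ * chi _).
    rewrite -(@gauss_nonsquare (M / (2%:R * w * s) ^+ 2)) //; last first.
      move=> x; apply/eqP => E; have := nM (x * (2%:R * w * s)).
      by rewrite exprMn E divfK ?eqxx // expf_neq0 // !mulf_neq0.
    by congr gauss; rewrite -Ew; field; rewrite ?s0 ?w0 ?two0 ?four0.
  by field; rewrite ?s0 ?t0 ?M0 ?four0.
have {}nt v : v ^+ 2 != t by rewrite (negbT (nt v)).
(* The scaling replaces [M] by the square [1] and [t] by [M t]. *)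
rewrite (reindex_inj (mulfI M0)) /=.
have := salie_square_le 1 (M * t); rewrite -normrN -sumrN.
congr (`|_| <= _); apply: eq_big => [s|s s0]; first by rewrite mulf_eq0 (negbTE M0).
rewrite gauss_nonsquare // mulNr; congr (- (_ * chi _)).
by rewrite expr1n; field; rewrite s0 M0 four0.
Qed.

End GaussSums.

(** * Character sums over spheres in [F_p^d] *)

Definition sqnorm (R : pzRingType) (d : nat) (x : 'rV[R]_d) : R := \sum_(i < d) x 0 i ^+ 2.
Definition dotv (R : pzRingType) (d : nat) (x y : 'rV[R]_d) : R := \sum_(i < d) x 0 i * y 0 i.

Lemma addchar_sum (V : zmodType) (chi : V -> algC) (I : finType) (f : I -> V) :
  addchar chi -> chi (\sum_i f i) = \prod_i chi (f i).
Proof. by move=> chiP; apply: (big_morph chi chiP.1 (addchar0 chiP)). Qed.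

Lemma sum_rV_prod (R : finNzRingType) (d : nat) (f : 'I_d -> R -> algC) :
  \sum_(x : 'rV[R]_d) \prod_i f i (x 0 i) = \prod_i \sum_u f i u.
Proof.
rewrite bigA_distr_bigA /= (reindex (fun g : {ffun 'I_d -> R} => \row_i g i)) /=.
  by apply: eq_bigr => g _; apply: eq_bigr => i _; rewrite mxE.
exists (fun x : 'rV[R]_d => [ffun i => x 0 i]) => [g _|x _].
  by apply/ffunP => i; rewrite ffunE mxE.
by apply/rowP => i; rewrite mxE ffunE.
Qed.

(** The condition [sqnorm x = t] is detected by a sum over [s]. The term [s = 0] is the subtracted
    main term; each other term is a product of [d] Gauss sums, whose pairs all contribute the same
    constant [gauss chi 1 ^+ 2], leaving one Gauss sum if [d] is odd and none if [d] is even. *)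
Lemma sphere_char_sum_le (p d : nat) (chi : 'F_p -> algC) (a t : 'F_p) (m : 'rV['F_p]_d) :
  prime p -> odd p -> addchar chi -> chi a != 1 -> t != 0 ->
  `|p%:R * (\sum_(x | sqnorm x == t) chi (dotv m x)) - (m == 0)%:R * p%:R ^+ d| ^+ 2
    <= (4 * p ^ d.+1)%:R.
Proof.
move=> pr_p odd_p chiP ca t0.
have two0 : 2%:R != 0 :> 'F_p := two_neq0_pchar (pchar_Fp pr_p) odd_p.
have four0 : 4%:R != 0 :> 'F_p by rewrite (natrM _ 2 2) mulf_neq0.
have Eall : p%:R * (\sum_(x | sqnorm x == t) chi (dotv m x)) =
  \sum_s chi (- (s * t)) * \prod_i \sum_u chi (s * u ^+ 2 + m 0 i * u).
  rewrite mulr_sumr big_mkcond /=.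
  transitivity (\sum_x \sum_s chi (s * (sqnorm x - t)) * chi (dotv m x)).
    apply: eq_bigr => x _; rewrite -mulr_suml (sum_addchar_scaled _ chiP ca) card_Fp // subr_eq0.
    by case: ifP => _; rewrite ?mul0r.
  rewrite exchange_big /=; apply: eq_bigr => s _.
  rewrite -sum_rV_prod mulr_sumr; apply: eq_bigr => x _.
  rewrite -addchar_sum // -!chiP.1; congr chi.
  by rewrite big_split /= -mulr_sumr /sqnorm /dotv; ring.
have E0 : \prod_i \sum_u chi (0 * u ^+ 2 + m 0 i * u) = (m == 0)%:R * p%:R ^+ d.
  under eq_bigr => i _.
    under eq_bigr do rewrite mul0r add0r mulrC.
    rewrite (sum_addchar_scaled _ chiP ca) card_Fp //; over.
  have [->|m0] := eqVneq m 0.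
    under eq_bigr do rewrite mxE eqxx.
    by rewrite prodr_const card_ord mul1r.
  have [i mi] : exists i, m 0 i != 0.
    apply/existsP; rewrite -[X in is_true X]negbK negb_exists; apply: contra m0 => /forallP m0.
    by apply/eqP/rowP => i; rewrite mxE; apply/eqP; have := m0 i; rewrite negbK.
  by rewrite (bigD1 i) //= (negbTE mi) !mul0r.
pose M := sqnorm m.
have Es s : s != 0 -> \prod_i \sum_u chi (s * u ^+ 2 + m 0 i * u) =
  gauss chi s ^+ d * chi (- (M / (4%:R * s))).
  move=> s0; under eq_bigr do rewrite (gauss_linear pr_p odd_p chiP) //.
  rewrite big_split /= prodr_const card_ord -addchar_sum //; congr (_ * chi _).
  by rewrite sumrN -mulr_suml.
have -> : p%:R * (\sum_(x | sqnorm x == t) chi (dotv m x)) - (m == 0)%:R * p%:R ^+ d =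
   (gauss chi 1 ^+ 2) ^+ d./2 *
   \sum_(s | s != 0) gauss chi s ^+ odd d * chi (- (s * t) - M / (4%:R * s)).
  rewrite Eall (bigD1 0) //= E0 mul0r oppr0 (addchar0 chiP) mul1r addrAC subrr add0r.
  rewrite mulr_sumr; apply: eq_bigr => s s0; rewrite Es //.
  rewrite -(gauss_sqr_const pr_p odd_p chiP ca s0) [RHS]mulrA -exprM -exprD.
  by rewrite mul2n addnC odd_double_half chiP.1 mulrCA.
rewrite normrM exprMn normrX exprAC normrX (gauss_norm pr_p odd_p chiP ca) ?oner_eq0 //.
set S := \sum_(s | _) _.
have bS : `|S| ^+ 2 <= (4 * p ^ (odd d).+1)%:R.
  rewrite /S; case: (odd d) => /=.
    under eq_bigr do rewrite expr1.
    have H := salie_le pr_p odd_p chiP ca M t0.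
    have -> : (4 * p ^ 2)%:R = (2 * p)%:R ^+ 2 :> algC by rewrite -natrX expnMn.
    by rewrite lerXn2r ?nnegrE ?ler0n.
  under eq_bigr do rewrite expr0 mul1r.
  rewrite expn1; have [M0|M0] := eqVneq M 0.
    (* For an isotropic frequency the Kloosterman sum degenerates to a full character sum without
       its term at 0. *)
    have -> : \sum_(s | s != 0) chi (- (s * t) - M / (4%:R * s)) = -1.
      transitivity (\sum_s chi (s * - t) - 1); last first.
        by rewrite (sum_addchar_scaled _ chiP ca) oppr_eq0 (negbTE t0) add0r.
      rewrite [in RHS](bigD1 0) //= mul0r (addchar0 chiP) addrAC subrr add0r.
      by apply: eq_bigr => s _; rewrite M0 mul0r subr0 mulrN.
    by rewrite normrN1 expr1n ler1n muln_gt0 /= prime_gt0.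
  have tn0 : - t != 0 by rewrite oppr_eq0.
  have c0 : t * M / 4%:R != 0 by rewrite !mulf_neq0 ?invr_eq0.
  (* The substitution [x = - t s] turns the phase into [x + c/x] with [c = t M / 4]. *)
  have -> : \sum_(s | s != 0) chi (- (s * t) - M / (4%:R * s)) = kloosterman chi (t * M / 4%:R).
    rewrite /kloosterman [RHS](reindex_inj (mulfI tn0)) /=.
    apply: eq_big => [s|s s0]; first by rewrite mulf_eq0 (negbTE tn0).
    by congr chi; field; rewrite s0 tn0 four0.
  rewrite real_normK ?kloosterman_real //.
  exact: kloosterman_sqr_le ca c0.
have -> : (4 * p ^ d.+1)%:R = p%:R ^+ d./2 ^+ 2 * (4 * p ^ (odd d).+1)%:R :> algC.
  rewrite -!natrX -natrM; congr _%:R; rewrite -[in LHS](odd_double_half d).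
  by rewrite -expnM muln2 mulnCA -expnD addnS addnC.
by rewrite exprAC ler_wpM2l // !exprn_ge0 // ler0n.
Qed.

(** * Spheres over a finite local ring with residue field F_p *)

Section DotProduct.
Variables (R : comPzRingType) (d : nat).
Implicit Types x y z : 'rV[R]_d.

Lemma dotvC x y : dotv x y = dotv y x.
Proof. by apply: eq_bigr => i _; rewrite mulrC. Qed.

Lemma dotvDr x y z : dotv x (y + z) = dotv x y + dotv x z.
Proof. by rewrite /dotv -big_split; apply: eq_bigr => i _; rewrite mxE mulrDr. Qed.

Lemma dotvZr (k : R) x y : dotv x (k *: y) = k * dotv x y.
Proof. by rewrite /dotv mulr_sumr; apply: eq_bigr => i _; rewrite mxE mulrCA. Qed.

Lemma dotvZl (k : R) x y : dotv (k *: x) y = k * dotv x y.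
Proof. by rewrite dotvC dotvZr dotvC. Qed.

Lemma dotvNr x y : dotv x (- y) = - dotv x y.
Proof. by rewrite -scaleN1r dotvZr mulN1r. Qed.

Lemma dotvDl x y z : dotv (x + y) z = dotv x z + dotv y z.
Proof. by rewrite dotvC dotvDr !(dotvC z). Qed.

Lemma dot0v x : dotv 0 x = 0.
Proof. by rewrite -(scale0r x) dotvZl mul0r. Qed.

Lemma sqnormE x : sqnorm x = dotv x x.
Proof. by apply: eq_bigr => i _; rewrite expr2. Qed.

Lemma sqnormZ (k : R) x : sqnorm (k *: x) = k ^+ 2 * sqnorm x.
Proof. by rewrite !sqnormE dotvZl dotvZr mulrA. Qed.

Lemma sqnormD x y : sqnorm (x + y) = sqnorm x + dotv x y *+ 2 + sqnorm y.
Proof. by rewrite !sqnormE dotvDr !dotvDl (dotvC y x); ring. Qed.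

Lemma sqnormN x : sqnorm (- x) = sqnorm x.
Proof. by rewrite -scaleN1r sqnormZ sqrrN expr1n mul1r. Qed.

Definition rotate (a b : 'I_d) (al be : R) x : 'rV[R]_d :=
  \row_i (if i == a then al * x 0 a - be * x 0 b
          else if i == b then be * x 0 a + al * x 0 b else x 0 i).

Lemma rotateK (a b : 'I_d) (al be : R) : a != b -> al ^+ 2 + be ^+ 2 = 1 ->
  cancel (rotate a b al be) (rotate a b al (- be)).
Proof.
move=> ab E x; have ba : b != a by rewrite eq_sym.
apply/rowP => i; rewrite !mxE eqxx (negbTE ba) eqxx.
have [->|ia] := eqVneq i a.
  by rewrite -[RHS]mul1r -E; ring.
have [->|//] := eqVneq i b.
by rewrite -[RHS]mul1r -E; ring.
Qed.

Lemma dotv_rotate (a b : 'I_d) (al be : R) x y : a != b ->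
  dotv y (rotate a b al be x) =
  dotv y x + (al - 1) * (y 0 a * x 0 a + y 0 b * x 0 b) + be * (y 0 b * x 0 a - y 0 a * x 0 b).
Proof.
move=> ab; have ba : b != a by rewrite eq_sym.
rewrite /dotv (bigD1 a) //= (bigD1 b) //= [in RHS](bigD1 a) //= [in RHS](bigD1 b) //=.
rewrite !mxE eqxx (negbTE ba) eqxx.
rewrite [X in _ + (_ + X) = _](eq_bigr (fun i => y 0 i * x 0 i)); first by ring.
by move=> i /andP[ia ib]; rewrite mxE (negbTE ia) (negbTE ib).
Qed.

Lemma sqnorm_rotate (a b : 'I_d) (al be : R) x : a != b -> al ^+ 2 + be ^+ 2 = 1 ->
  sqnorm (rotate a b al be x) = sqnorm x.
Proof.
move=> ab E; have ba : b != a by rewrite eq_sym.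
rewrite /sqnorm (bigD1 a) //= (bigD1 b) //= [in RHS](bigD1 a) //= [in RHS](bigD1 b) //=.
rewrite !mxE eqxx (negbTE ba) eqxx.
rewrite [X in _ + (_ + X) = _](eq_bigr (fun i => x 0 i ^+ 2)).
  by rewrite !addrA; congr (_ + _); rewrite -[RHS]mul1r -E; ring.
by move=> i /andP[ia ib]; rewrite mxE (negbTE ia) (negbTE ib).
Qed.

End DotProduct.

Section LocalRing.
Variables (R : finComUnitRingType) (p l d : nat) (rho : {rmorphism R -> 'F_p}).
Hypotheses (pr_p : prime p) (odd_p : odd p) (l_gt0 : (0 < l)%N).
Hypothesis unit_rho : forall x, (x \is a GRing.unit) = (rho x != 0).
Hypothesis ker_rho : forall x, rho x = 0 -> exists y, x = p%:R * y.
Hypothesis p_nilp : p%:R ^+ l = 0 :> R.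
Variable t : R.
Hypothesis t_unit : t \is a GRing.unit.

Local Notation V := 'rV[R]_d.
Local Notation rv := (map_mx rho).

Let two_F : 2%:R != 0 :> 'F_p := two_neq0_pchar (pchar_Fp pr_p) odd_p.

Lemma sqnorm_rho (x : V) : sqnorm (rv x) = rho (sqnorm x).
Proof. by rewrite rmorph_sum; apply: eq_bigr => i _; rewrite mxE rmorphXn. Qed.

Lemma dotv_rho (x y : V) : dotv (rv x) (rv y) = rho (dotv x y).
Proof. by rewrite rmorph_sum; apply: eq_bigr => i _; rewrite !mxE rmorphM. Qed.

Lemma rho_p : rho p%:R = 0.
Proof. by rewrite rmorph_nat (pcharf0 (pchar_Fp pr_p)). Qed.

Definition reflect_vec (w z : V) : V := z - (dotv z w *+ 2 / sqnorm w) *: w.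

Lemma sqnorm_reflect (w z : V) : sqnorm w \is a GRing.unit ->
  sqnorm (reflect_vec w z) = sqnorm z.
Proof.
move=> uw; rewrite /reflect_vec sqnormD sqnormN sqnormZ dotvNr dotvZr.
set s := sqnorm w in uw *.
have -> : (dotv z w *+ 2 / s) ^+ 2 * s = (dotv z w *+ 2) ^+ 2 / s.
  transitivity ((dotv z w *+ 2) ^+ 2 * s^-1 * (s^-1 * s)); first by ring.
  by rewrite mulVr // mulr1.
by ring.
Qed.

Lemma reflectK (w : V) : sqnorm w \is a GRing.unit -> involutive (reflect_vec w).
Proof.
move=> uw z; rewrite /reflect_vec dotvDl -scaleNr dotvZl -sqnormE scaleNr.
set s := sqnorm w in uw *.
have -> : (dotv z w + - (dotv z w *+ 2 / s) * s) = - dotv z w.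
  by rewrite mulNr divrK //; ring.
by rewrite mulNrn mulNr scaleNr opprK subrK.
Qed.

Lemma rv_reflect (w z z' : V) : rv z = rv z' -> rv (reflect_vec w z) = rv (reflect_vec w z').
Proof.
move=> E; have Ei i : rho (z 0 i) = rho (z' 0 i) by have /rowP/(_ i) := E; rewrite !mxE.
have Ed : rho (dotv z w) = rho (dotv z' w) by rewrite -!dotv_rho E.
apply/rowP => i; rewrite !mxE !(rmorphB rho) Ei; congr (_ - _).
by rewrite !(rmorphM rho _ (w 0 i)) !(rmorphM rho _ (sqnorm w)^-1) !(rmorphMn rho 2) Ed.
Qed.

Lemma sphere_transitive (x y : V) : sqnorm x = t -> sqnorm y = t ->
  exists g : V -> V, [/\ involutive g, (forall z, sqnorm (g z) = sqnorm z),
    (forall z z', rv z = rv z' -> rv (g z) = rv (g z')) & g x = y].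
Proof.
move=> Ex Ey.
(* For [x] and [u] on the same sphere [2 x.(x - u) = sqnorm (x - u)], so the reflection along
   [x - u] subtracts exactly [x - u] from [x]. *)
have tr u : sqnorm u = t -> sqnorm (x - u) \is a GRing.unit -> reflect_vec (x - u) x = u.
  move=> Eu uu; rewrite /reflect_vec.
  have -> : dotv x (x - u) *+ 2 = sqnorm (x - u).
    by rewrite sqnormD sqnormN !dotvDr dotvNr -sqnormE Ex Eu; ring.
  by rewrite divrr // scale1r opprB addrCA subrr addr0.
(* sqnorm (x - y) + sqnorm (x + y) = 4 t, so one of the two is a unit. *)
have [u1|nu1] := boolP (sqnorm (x - y) \is a GRing.unit).
  exists (reflect_vec (x - y)); split; [exact: reflectK| | |exact: tr].
    by move=> z; apply: sqnorm_reflect.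
  by move=> z z'; apply: rv_reflect.
have u2 : sqnorm (x - - y) \is a GRing.unit.
  move: nu1 t_unit; rewrite !unit_rho negbK => /eqP E t0.
  have -> : sqnorm (x - - y) = t *+ 4 - sqnorm (x - y).
    by rewrite !sqnormD !sqnormN !dotvNr Ex Ey; ring.
  rewrite rmorphB /= E subr0 rmorphMn /= -mulr_natr mulf_neq0 //.
  by rewrite (natrM _ 2 2) mulf_neq0.
have rN w z : reflect_vec w (- z) = - reflect_vec w z.
  by rewrite /reflect_vec -[- z]scaleN1r dotvZl !mulN1r mulNrn mulNr !scaleNr scale1r opprB opprK addrC.
exists (fun z => - reflect_vec (x - - y) z); split.
- by move=> z; rewrite rN opprK reflectK.
- by move=> z; rewrite sqnormN sqnorm_reflect.
- by move=> z z' E; rewrite !map_mxN (rv_reflect _ E).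
by rewrite tr ?sqnormN // opprK.
Qed.

(** Each [p]-th power gains a factor [p]: the cofactor of [v - 1] in [v^p - 1] is a sum of [p] terms
    congruent to 1. *)
Lemma one_unit_expr (u : R) k : rho u = 1 -> exists c, u ^+ (p ^ k) - 1 = p%:R ^+ k.+1 * c.
Proof.
move=> u1; elim: k => [|k [c IH]].
  rewrite expn0 expr1 expr1; apply: ker_rho.
  by rewrite rmorphB rmorph1 u1 subrr.
rewrite expnSr exprM subrX1 IH.
have [c' ->] : exists c', \sum_(i < p) (u ^+ (p ^ k)) ^+ i = p%:R * c'.
  apply: ker_rho; rewrite rmorph_sum (eq_bigr (fun=> 1)) => [|i _].
    by rewrite sumr_const card_ord (pcharf0 (pchar_Fp pr_p)).
  by rewrite !rmorphXn /= u1 !expr1n.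
by exists (c * c'); rewrite [in RHS]exprSr; ring.
Qed.

(* The ratio of sqnorm z to t is a one-unit u with u^(p^l) = 1, so u^((p^l + 1)/2) is a
   square root of u by which z can be rescaled. *)
Lemma hensel_sphere (z : V) : rho (sqnorm z) = rho t ->
  exists y : V, sqnorm y = t /\ rv y = rv z.
Proof.
move=> E; pose u := sqnorm z / t.
have t0 : rho t != 0 by rewrite -unit_rho.
have ru : rho u = 1 by rewrite /u rmorphM rmorphV //= E divff.
have u1 : u ^+ (p ^ l) = 1.
  have [c /eqP] := one_unit_expr l ru.
  by rewrite exprS p_nilp mulr0 mul0r subr_eq0 => /eqP.
pose w := u ^+ (p ^ l).+1./2.
have w2 : w ^+ 2 = u.
  rewrite /w -exprM; have -> : ((p ^ l).+1./2 * 2 = (p ^ l).+1)%N.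
    have : odd (p ^ l) by rewrite oddX odd_p orbT.
    by move: (p ^ l)%N => N; lia.
  by rewrite exprS u1 mulr1.
have rw : rho w = 1 by rewrite rmorphXn /= ru expr1n.
have wu : w \is a GRing.unit by rewrite unit_rho rw oner_eq0.
exists (w^-1 *: z); split; last first.
  by rewrite map_mxZ rmorphV // rw invr1 scale1r.
rewrite sqnormZ exprVn w2.
have -> : sqnorm z = u * t by rewrite /u divrK.
by rewrite mulrA mulVr ?mul1r // unit_rho ru oner_eq0.
Qed.

Definition fiber (xb : 'rV['F_p]_d) : {set V} := [set x | (sqnorm x == t) && (rv x == xb)].

(** Every point of the sphere over [F_p] lifts by [hensel_sphere], and the isometries of
    [sphere_transitive] respect reduction, so they carry one fiber bijectively onto another. If the
    sphere is empty, [c = 0]. *)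
Lemma card_fiber : exists c, forall xb,
  #|fiber xb| = if sqnorm xb == rho t then c else 0%N.
Proof.
have out xb : sqnorm xb != rho t -> #|fiber xb| = 0%N.
  move=> nx; apply/eqP; rewrite cards_eq0; apply/eqP/setP => x; rewrite !inE.
  by apply: contraNF nx => /andP[/eqP <- /eqP <-]; rewrite sqnorm_rho.
case: (pickP [pred x : V | sqnorm x == t]) => [x0 /eqP Ex0|none]; last first.
  exists 0%N => xb; case: ifP => [|/negbT]; last exact: out.
  move=> /eqP E; apply/eqP; rewrite cards_eq0; apply/eqP/setP => x; rewrite !inE.
  by have := none x => /= ->.
exists #|fiber (rv x0)| => xb; case: ifP => [/eqP Exb|/negbT]; last exact: out.
have [z Ez] : exists z : V, rv z = xb.
  exists (\row_i (xb 0 i : nat)%:R); apply/rowP => i.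
  by rewrite !mxE rmorph_nat natr_Zp.
have [x [Ex Exz]] : exists y : V, sqnorm y = t /\ rv y = rv z.
  by apply: hensel_sphere; rewrite -sqnorm_rho Ez.
rewrite -Ez -Exz.
have [g [gK gN gr gx]] := sphere_transitive Ex Ex0.
have gy : g x0 = x by rewrite -gx gK.
rewrite -(card_imset _ (inv_inj gK)); congr #|pred_of_set _|; apply/setP => y.
rewrite [RHS]inE; apply/imsetP/andP => [[z']|[Ny /eqP ry]].
  by rewrite inE => /andP[Nz /eqP rz] ->; rewrite gN Nz -gx (gr _ _ rz) eqxx.
exists (g y); last by rewrite gK.
by rewrite inE gN Ny -gy (gr _ _ ry) eqxx.
Qed.

(** * The Fourier transform of the sphere, frequency by frequency *)

Variable e : R -> algC.
Hypothesis eP : addchar e.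
Hypothesis e_prim : forall y, rho y != 0 -> e (p%:R ^+ l.-1 * y) != 1.

Lemma vec_valuation (m : V) : m != 0 ->
  exists j m', [/\ (j < l)%N, m = p%:R ^+ j *: m' & rv m' != 0].
Proof.
move=> m0.
have H k : (exists j m', [/\ (j < k)%N, m = p%:R ^+ j *: m' & rv m' != 0]) \/
   exists m', m = p%:R ^+ k *: m'.
  elim: k => [|k [[j [m' [jk E n0]]]|[m' E]]]; first by right; exists m; rewrite scale1r.
    by left; exists j, m'; split=> //; exact: ltnW.
  have [r0|nr0] := eqVneq (rv m') 0; last by left; exists k, m'.
  right.
  have /fin_all_exists[f Hf] : forall i, exists y, m' 0 i = p%:R * y.
    by move=> i; apply: ker_rho; have /rowP/(_ i) := r0; rewrite !mxE.
  exists (\row_i f i); rewrite exprSr -scalerA E; congr (_ *: _).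
  by apply/rowP => i; rewrite !mxE Hf.
case: (H l) => // -[m' E]; by rewrite E p_nilp scale0r eqxx in m0.
Qed.

(** The restriction of [e] to the ideal generated by [p^(l-1)], seen as a character of the residue
    field; by [top_charE] the choice of the lift of [b] is immaterial. *)
Definition top_char (b : 'F_p) : algC := e (p%:R ^+ l.-1 * (b : nat)%:R).

Lemma top_charE y : e (p%:R ^+ l.-1 * y) = top_char (rho y).
Proof.
have [z Ez] : exists z, y - (rho y : nat)%:R = p%:R * z.
  by apply: ker_rho; rewrite rmorphB rmorph_nat natr_Zp subrr.
rewrite /top_char -[in LHS](subrK (rho y : nat)%:R y) Ez mulrDr mulrA -exprSr prednK //.
by rewrite p_nilp mul0r add0r.
Qed.

Lemma rho_nat (b : 'F_p) : rho (b : nat)%:R = b.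
Proof. by rewrite rmorph_nat natr_Zp. Qed.

Lemma top_charP : addchar top_char.
Proof.
split=> [b c|b]; last exact: eP.2.
by rewrite -{1}[b]rho_nat -{1}[c]rho_nat -rmorphD -top_charE mulrDr eP.1.
Qed.

Lemma top_char1 (b : 'F_p) : b != 0 -> top_char b != 1.
Proof. by move=> b0; rewrite /top_char e_prim // rho_nat. Qed.

Definition sphere_hat (m : V) : algC := \sum_(x | sqnorm x == t) e (dotv m x).

Lemma sphere_hat_fibers m : sphere_hat m = \sum_xb \sum_(x in fiber xb) e (dotv m x).
Proof.
rewrite /sphere_hat (partition_big (fun x => rv x) xpredT) //=.
by apply: eq_bigr => xb _; apply: eq_bigl => x; rewrite inE.
Qed.

Section UniformFibers.
Variable c : nat.
Hypothesis cP : forall xb : 'rV['F_p]_d, #|fiber xb| = if sqnorm xb == rho t then c else 0%N.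

Lemma sphere_hat_top m' : sphere_hat (p%:R ^+ l.-1 *: m') =
  c%:R * \sum_(xb | sqnorm xb == rho t) top_char (dotv (rv m') xb).
Proof.
rewrite sphere_hat_fibers mulr_sumr [RHS]big_mkcond; apply: eq_bigr => xb _.
rewrite (eq_bigr (fun=> top_char (dotv (rv m') xb))); last first.
  by move=> x; rewrite inE => /andP[_ /eqP <-]; rewrite dotvZl top_charE dotv_rho.
by rewrite sumr_const cP; case: ifP; rewrite ?mulr0n // mulr_natl.
Qed.

(** A rotation in the plane [(a, b)] with parameter [tau = p^(l-1-j)] is congruent to 1 mod [p], so
    it preserves the fiber. It changes the phase by [p^(l-1)] times a unit multiple of the minor,
    the terms in [tau^2] being killed by [p^j]; hence it multiplies the sum by some [w != 1]. *)
Lemma fiber_sum_eq0 (j : nat) (m' : V) (xb : 'rV['F_p]_d) (a b : 'I_d) : (j.+1 < l)%N ->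
  a != b -> rv m' 0 b * xb 0 a - rv m' 0 a * xb 0 b != 0 ->
  \sum_(x in fiber xb) e (dotv (p%:R ^+ j *: m') x) = 0.
Proof.
move=> jl ab minor.
pose tau : R := p%:R ^+ (l.-1 - j).
have tj : p%:R ^+ j * tau = p%:R ^+ l.-1.
  by rewrite -exprD; congr (_ ^+ _); lia.
have rp : rho p%:R = 0 := rho_p.
have rtau : rho tau = 0.
  by rewrite rmorphXn /= rp expr0n; have -> : (l.-1 - j == 0)%N = false by lia.
pose n := 1 + tau ^+ 2.
have un : n \is a GRing.unit.
  by rewrite unit_rho rmorphD rmorph1 rmorphXn /= rtau expr0n addr0 oner_eq0.
(* Rational parametrization of the circle [al^2 + be^2 = 1]. *)
pose al := (1 - tau ^+ 2) / n; pose be := tau *+ 2 / n.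
have nV : n * n^-1 = 1 by rewrite divrr.
have E1 : al ^+ 2 + be ^+ 2 = 1.
  transitivity ((n * n^-1) ^+ 2); last by rewrite nV expr1n.
  by rewrite /al /be /n; ring.
have Eal : al - 1 = - (tau ^+ 2 *+ 2) / n.
  rewrite -nV /al /n; ring.
have tt : p%:R ^+ j * (tau * tau) = 0.
  rewrite mulrA tj -exprD; have -> : (l.-1 + (l.-1 - j) = l + (l.-1 - j).-1)%N by lia.
  by rewrite exprD p_nilp mul0r.
have rn : rho n = 1 by rewrite /n rmorphD rmorph1 rmorphXn /= rtau expr0n addr0.
have ral : rho al = 1.
  by rewrite /al rmorphM rmorphB rmorph1 rmorphXn /= rtau expr0n subr0 rmorphV // rn invr1 mulr1.
have rbe : rho be = 0 by rewrite /be rmorphM rmorphMn /= rtau mul0rn mul0r.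
have rrot be' z : rho be' = 0 -> rv (rotate a b al be' z) = rv z.
  move=> r0; apply/rowP => i; rewrite !mxE.
  have [->|_] := eqVneq i a; first by rewrite rmorphB (rmorphM rho al) (rmorphM rho be') r0 ral mul0r subr0 mul1r.
  by have [->|_] := eqVneq i b; first by rewrite rmorphD (rmorphM rho al) (rmorphM rho be') r0 ral mul0r add0r mul1r.
set w := top_char (2%:R * (rv m' 0 b * xb 0 a - rv m' 0 a * xb 0 b)).
have w1 : w != 1 by apply: top_char1; rewrite mulf_neq0.
set I := \sum_(_ in _) _; suff : I = w * I.
  move/eqP; rewrite eq_sym -subr_eq0 -{2}[I]mul1r -mulrBl mulf_eq0 subr_eq0 (negbTE w1) => /eqP //.
have E1' : al ^+ 2 + (- be) ^+ 2 = 1 by rewrite sqrrN.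
have Krot : cancel (rotate a b al be) (rotate a b al (- be)) by exact: rotateK.
have Krot' : cancel (rotate a b al (- be)) (@rotate _ d a b al be).
  by have := @rotateK _ d a b al (- be) ab E1'; rewrite opprK.
rewrite {1}/I (reindex (rotate a b al be)); last by exists (rotate a b al (- be)) => z _.
rewrite /I mulr_sumr; apply: eq_big => [x|x].
  by rewrite !inE sqnorm_rotate // rrot.
rewrite inE sqnorm_rotate // rrot // => /andP[_ /eqP Exb].
have -> : dotv (p%:R ^+ j *: m') (rotate a b al be x) = dotv (p%:R ^+ j *: m') x +
    p%:R ^+ l.-1 * (2%:R * (m' 0 b * x 0 a - m' 0 a * x 0 b) / n).
  rewrite !dotvZl dotv_rotate // Eal.
  set A := _ + m' 0 b * x 0 b; set B := m' 0 b * x 0 a - _.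
  transitivity (p%:R ^+ j * dotv m' x + p%:R ^+ j * (tau * tau) * (- 2%:R / n * A) +
     p%:R ^+ j * tau * (2%:R * B / n)); first by rewrite /be; ring.
  by rewrite tt mul0r addr0 tj.
rewrite eP.1 top_charE mulrC /w; congr (top_char _ * _).
by rewrite rmorphM rmorphV // rn invr1 mulr1 rmorphM rmorph_nat rmorphB !rmorphM -Exb !mxE.
Qed.

(** A reduction [xb] that is not parallel to [m'] has a nonzero minor with it, and its fiber sum
    vanishes. On the line spanned by [m'] the sphere cuts out at most two points, each contributing
    at most [c]. *)
Lemma sphere_hat_low (j : nat) (m' : V) : (j.+1 < l)%N -> rv m' != 0 ->
  `|sphere_hat (p%:R ^+ j *: m')| <= (2 * c)%:R.
Proof.
move=> jl m0; have [i mi] : exists i, rv m' 0 i != 0.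
  apply/existsP; rewrite -[X in is_true X]negbK negb_exists; apply: contra m0 => /forallP m0.
  by apply/eqP/rowP => i; rewrite [RHS]mxE; apply/eqP; have := m0 i; rewrite negbK.
pose par := [set xb : 'rV['F_p]_d | (sqnorm xb == rho t) && (xb == (xb 0 i / rv m' 0 i) *: rv m')].
have bound xb : `|\sum_(x in fiber xb) e (dotv (p%:R ^+ j *: m') x)| <= (if xb \in par then c%:R else 0).
  rewrite inE; case: andP => [[/eqP Exb _]|npar].
    apply: le_trans (ler_norm_sum _ _ _) _.
    rewrite (eq_bigr (fun=> 1)); last by move=> x _; rewrite eP.2.
    by rewrite sumr_const cP Exb eqxx.
  have [Exb|nxb] := eqVneq (sqnorm xb) (rho t); last first.
    by rewrite big1 ?normr0 // => x; move: (cP xb); rewrite (negbTE nxb) => /card0_eq ->.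
  have [k nk] : exists k, xb 0 k != xb 0 i / rv m' 0 i * rv m' 0 k.
    apply/existsP; rewrite -[X in is_true X]negbK negb_exists; apply/negP => /forallP m1.
    apply: npar; split; first exact/eqP.
    by apply/eqP/rowP => k; rewrite mxE; apply/eqP; have := m1 k; rewrite negbK.
  rewrite (@fiber_sum_eq0 j m' xb i k jl) ?normr0 //.
    by apply: contraNneq nk => <-; rewrite divfK.
  apply: contraNneq nk => /eqP; rewrite subr_eq0 => /eqP E; apply/eqP/(mulfI mi).
  by rewrite -E; field.
have cpar : (#|par| <= 2)%N.
  (* The scalars of parallel points are roots of [P], which is nonzero even when [m'] is isotropic
     mod [p], thanks to its constant term. *)
  pose P : {poly 'F_p} := sqnorm (rv m') *: 'X^2 - (rho t)%:P.
  have t0 : rho t != 0 by rewrite -unit_rho.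
  have szP : (size P <= 3)%N.
    apply: leq_trans (size_polyD _ _) _; rewrite size_polyN geq_max.
    rewrite (leq_trans (size_scale_leq _ _)) ?size_polyXn //.
    by rewrite (leq_trans (size_polyC_leq1 _)).
  have P0 : P != 0.
    apply/negP => /eqP /(congr1 (fun q : {poly 'F_p} => q.[0])).
    rewrite /P hornerD hornerN hornerC hornerZ hornerXn expr0n mulr0 add0r horner0 => /eqP.
    by rewrite oppr_eq0 (negbTE t0).
  rewrite -ltnS; apply: leq_trans szP.
  have inj : {in par &, injective (fun xb : 'rV['F_p]_d => xb 0 i / rv m' 0 i)}.
    move=> x y; rewrite !inE => /andP[_ /eqP Ex] /andP[_ /eqP Ey] E.
    by rewrite Ex Ey E.
  rewrite -(card_in_imset inj) cardE; apply: max_poly_roots; rewrite ?enum_uniq //.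
  apply/allP => y; rewrite mem_enum => /imsetP[xb]; rewrite inE => /andP[/eqP Ex /eqP Epar] ->.
  have Exb : sqnorm xb = (xb 0 i / rv m' 0 i) ^+ 2 * sqnorm (rv m') by rewrite {1}Epar sqnormZ.
  by apply/rootP; rewrite /P hornerD hornerN hornerC hornerZ hornerXn -Ex Exb mulrC subrr.
rewrite sphere_hat_fibers; apply: le_trans (ler_norm_sum _ _ _) _.
apply: (@le_trans _ _ (\sum_xb (if xb \in par then c%:R else 0))).
  by apply: ler_sum => xb _.
rewrite -big_mkcond /= sumr_const -mulrnA ler_nat mulnC leq_mul //.
Qed.

End UniformFibers.

Lemma sum_dot_char (v : V) : \sum_m e (dotv m v) = if v == 0 then #|{: V}|%:R else 0.
Proof.
have [->|v0] := eqVneq v 0.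
  rewrite (eq_bigr (fun=> 1)) ?sumr_const // => m _.
  by rewrite dotvC dot0v (addchar0 eP).
have [j [v' [jl Ev nz]]] := vec_valuation v0.
have [i vi] : exists i, rv v' 0 i != 0.
  apply/existsP; rewrite -[X in is_true X]negbK negb_exists; apply: contra nz => /forallP m0.
  by apply/eqP/rowP => i; rewrite [RHS]mxE; apply/eqP; have := m0 i; rewrite negbK.
(* Chosen so that [m0 . v] is [p^(l-1)] times the coordinate [v' 0 i], a unit, where [e] is not
   1. *)
pose m0 : V := \row_k (if k == i then p%:R ^+ (l.-1 - j) else 0).
apply: (@sum_addchar _ (fun m : V => e (dotv m v)) m0).
  by split=> [x y|x]; rewrite ?dotvDl ?eP.1 ?eP.2.
have -> : dotv m0 v = p%:R ^+ l.-1 * v' 0 i.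
  rewrite /dotv (bigD1 i) //= big1 ?addr0 => [|k /negbTE ki]; rewrite mxE ?ki ?mul0r //.
  rewrite eqxx Ev mxE mulrA -exprD; congr (_ ^+ _ * _); lia.
by apply: e_prim; rewrite mxE in vi.
Qed.

(** * Sets without pairs at distance [t] *)

Variable E : {set V}.

Definition set_hat (m : V) : algC := \sum_(x in E) e (dotv m x).

Lemma set_hat_norm m : `|set_hat m| ^+ 2 = \sum_(x in E) \sum_(y in E) e (dotv m (x - y)).
Proof.
rewrite normCK /set_hat rmorph_sum big_distrlr /=; apply: eq_bigr => x _; apply: eq_bigr => y _.
by rewrite conj_addchar // -eP.1 dotvDr dotvNr.
Qed.

Lemma set_hat_plancherel : \sum_m `|set_hat m| ^+ 2 = (#|{: V}| * #|E|)%:R.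
Proof.
under eq_bigr do rewrite set_hat_norm.
rewrite exchange_big /= natrM mulr_natr -sumr_const; apply: eq_bigr => x xE.
rewrite exchange_big /= (bigD1 x) //= sum_dot_char subrr eqxx big1 ?addr0 // => y /andP[_ yx].
by rewrite sum_dot_char subr_eq0 eq_sym (negbTE yx).
Qed.

Hypothesis E_avoids : forall x y, x \in E -> y \in E -> sqnorm (x - y) != t.

(** By orthogonality the sum is [#|V|] times the number of triples [(s, x, y)] with [s] on the
    sphere, [x] and [y] in [E], and [s + x - y = 0]. *)
Lemma avoiding_sum_eq0 : \sum_m sphere_hat m * `|set_hat m| ^+ 2 = 0.
Proof.
under eq_bigr do rewrite set_hat_norm /sphere_hat mulr_suml.
rewrite exchange_big /= big1 // => s /eqP Es.
under eq_bigr do rewrite mulr_sumr.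
rewrite exchange_big /= big1 // => x xE.
under eq_bigr do rewrite mulr_sumr.
rewrite exchange_big /= big1 // => y yE.
under eq_bigr do rewrite -eP.1 -dotvDr.
rewrite sum_dot_char; case: eqP => // /eqP; rewrite addrC addr_eq0 => /eqP Exy.
by have := E_avoids xE yE; rewrite Exy sqnormN Es eqxx.
Qed.

Hypothesis d_gt0 : (0 < d)%N.

Lemma sphere_hat_le c (m : V) :
  (forall xb : 'rV['F_p]_d, #|fiber xb| = if sqnorm xb == rho t then c else 0%N) ->
  m != 0 -> `|sphere_hat m| <= c%:R * sqrtC (4 * p ^ d.-1)%:R.
Proof.
move=> cP m0; have p0 := prime_gt0 pr_p.
have [j [m' [jl -> nz]]] := vec_valuation m0.
have [jl1|jl1] := ltnP j.+1 l.
  apply: le_trans (sphere_hat_low cP jl1 nz) _.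
  rewrite mulnC natrM ler_wpM2l ?ler0n //.
  rewrite -(@ler_pXn2r _ 2) ?nnegrE ?sqrtC_ge0 ?ler0n //.
  by rewrite sqrtCK -natrX ler_nat -[(2 ^ 2)%N]muln1 leq_mul2l expn_gt0 p0.
have -> : j = l.-1 by lia.
rewrite (sphere_hat_top cP) normrM normr_nat ler_wpM2l ?ler0n //.
rewrite -(@ler_pXn2r _ 2) ?nnegrE ?sqrtC_ge0 ?ler0n // sqrtCK.
have t0 : rho t != 0 by rewrite -unit_rho.
have tc := top_charP.
have tc1 : top_char (1 : 'F_p) != 1 by apply: top_char1; rewrite oner_eq0.
have := sphere_char_sum_le (rv m') pr_p odd_p tc tc1 t0.
rewrite (negbTE nz) mul0r subr0 normrM normr_nat exprMn.
have -> : (4 * p ^ d.+1)%:R = p%:R ^+ 2 * (4 * p ^ d.-1)%:R :> algC.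
  by rewrite -natrX -natrM mulnCA -expnD; congr (_ * _ ^ _)%:R; lia.
by rewrite ler_pM2l // exprn_gt0 // ltr0n.
Qed.

(** Isolating [m = 0] in [avoiding_sum_eq0] and applying [sphere_hat_le] and Plancherel to the rest
    gives [N |E| <= 2 sqrt(P) |V|], where [N] is the size of the sphere over [F_p]. Combined with
    [N >= P/2], this yields the constant [16 = 4 * 4]. *)
Lemma avoiding_card_le : (p ^ d.-1 * #|E| ^ 2 <= 16 * #|{: V}| ^ 2)%N.
Proof.
have p0 := prime_gt0 pr_p.
set P := (p ^ d.-1)%N.
(* For [P < 16] the bound [|E| <= |V|] suffices. For [P >= 16] the estimate [(N - P)^2 <= 4P]
   excludes [N < P/2]. *)
have [P16|P16] := ltnP P 16.
  by apply: leq_mul; rewrite ?leq_sqr ?max_card // ltnW.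
have t0 : rho t != 0 by rewrite -unit_rho.
have [c cP] := card_fiber.
set Sb := [set xb : 'rV['F_p]_d | sqnorm xb == rho t].
set N := #|Sb|.
have tc := top_charP.
have tc1 : top_char (1 : 'F_p) != 1 by apply: top_char1; rewrite oner_eq0.
have EN : \sum_(x | sqnorm x == rho t) top_char (dotv (0 : 'rV['F_p]_d) x) = N%:R.
  rewrite (eq_bigr (fun=> 1)); last by move=> x _; rewrite dot0v (addchar0 tc).
  by rewrite sumr_const /N /Sb cardsE.
have N2 : (P <= 2 * N)%N.
  have := sphere_char_sum_le (0 : 'rV_d) pr_p odd_p tc tc1 t0.
  rewrite EN eqxx mul1r.
  have -> : p%:R * N%:R - p%:R ^+ d = p%:R * (N%:R - P%:R) :> algC.
    by rewrite mulrBr; congr (_ - _); rewrite -natrX -natrM -expnS prednK.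
  rewrite normrM normr_nat exprMn.
  have -> : (4 * p ^ d.+1)%:R = p%:R ^+ 2 * (4 * P)%:R :> algC.
    by rewrite -natrX -natrM mulnCA -expnD; congr (_ * _ ^ _)%:R; lia.
  rewrite ler_pM2l ?exprn_gt0 ?ltr0n // => H.
  rewrite leqNgt; apply/negP => NP.
  have NleP : (N <= P)%N by lia.
  move: H; rewrite distrC -natrB // normr_nat -natrX ler_nat.
  by clear -NP P16 NleP; nia.
have c0 : (0 < c)%N.
  have : (0 < N)%N by lia.
  rewrite card_gt0 => /set0Pn[xb]; rewrite inE => /eqP Exb.
  have [z Ez] : exists z : V, rv z = xb.
    by exists (\row_i (xb 0 i : nat)%:R); apply/rowP => i; rewrite !mxE rmorph_nat natr_Zp.
  have [y [Ey ry]] : exists y : V, sqnorm y = t /\ rv y = rv z.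
    by apply: hensel_sphere; rewrite -sqnorm_rho Ez.
  have := cP xb; rewrite Exb eqxx => <-; apply/card_gt0P; exists y.
  by rewrite inE Ey eqxx ry Ez /=.
have [E0|E0] := posnP #|E|; first by rewrite E0 muln0.
pose la : algC := sqrtC (4 * P)%:R.
have la0 : 0 <= la by rewrite sqrtC_ge0 ler0n.
have S0 : sphere_hat (0 : V) = (c * N)%:R.
  have := sphere_hat_top cP 0.
  by rewrite scaler0 map_mx0 EN natrM.
have H0 : set_hat 0 = #|E|%:R.
  rewrite /set_hat (eq_bigr (fun=> 1)) ?sumr_const // => x _.
  by rewrite dot0v (addchar0 eP).
have main : (c * N * #|E| ^ 2)%:R <= c%:R * la * (#|{: V}| * #|E|)%:R.
  have := avoiding_sum_eq0; rewrite (bigD1 0) //= S0 H0 normr_nat -natrX -natrM.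
  move/eqP; rewrite addr_eq0 => /eqP Emain.
  have -> : (c * N * #|E| ^ 2)%:R = `|(c * N * #|E| ^ 2)%:R| :> algC by rewrite normr_nat.
  rewrite Emain normrN; apply: le_trans (ler_norm_sum _ _ _) _.
  rewrite -set_hat_plancherel mulr_sumr.
  rewrite [X in _ <= X](bigD1 0) //= -[X in X <= _]add0r lerD //.
    by rewrite !mulr_ge0 ?ler0n ?exprn_ge0.
  apply: ler_sum => m m0; rewrite normrM [`|_ ^+ 2|]ger0_norm ?exprn_ge0 //.
  by rewrite ler_wpM2r ?exprn_ge0 // sphere_hat_le.
have {}main : (N * #|E|)%:R <= la * #|{: V}|%:R.
  have cE : 0 < (c * #|E|)%:R :> algC by rewrite ltr0n muln_gt0 c0.
  rewrite -(ler_pM2l cE); apply: le_trans (le_trans main _); rewrite le_eqVlt; apply/orP; left; apply/eqP.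
    by rewrite -natrM; congr _%:R; rewrite -mulnn; lia.
  by rewrite !natrM; ring.
have : ((N * #|E|)%:R : algC) ^+ 2 <= (la * #|{: V}|%:R) ^+ 2.
  by rewrite lerXn2r ?nnegrE ?mulr_ge0 ?ler0n.
rewrite exprMn sqrtCK -!natrX -natrM ler_nat expnMn.
have : (P ^ 2 <= 4 * N ^ 2)%N by rewrite -(expnMn 2 N 2) leq_sqr.
have P0 : (0 < P)%N by lia.
move: (#|E| ^ 2)%N (#|{: V}| ^ 2)%N (N ^ 2)%N => e2 v2 n2 h1 h2.
rewrite -(leq_pmul2l P0).
have h3 : (P ^ 2 * e2 <= 4 * n2 * e2)%N by rewrite leq_mul2r h1 orbT.
have -> : (P * (P * e2) = P ^ 2 * e2)%N by rewrite mulnA mulnn.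
lia.
Qed.

End LocalRing.

(** * The rings Z/p^l *)

Section ResidueRing.
Variables (p l : nat).
Hypotheses (pr_p : prime p) (l_gt0 : (0 < l)%N).
Local Notation q := (p ^ l)%N.

Let q_gt1 : (1 < q)%N.
Proof. by rewrite -(expn0 p) ltn_exp2l // prime_gt1. Qed.

Let natr_modq n : (n %% q)%:R = n%:R :> 'F_p.
Proof.
rewrite [in RHS](divn_eq n q) natrD natrM.
have -> : q%:R = 0 :> 'F_p by rewrite natrX (pcharf0 (pchar_Fp pr_p)) expr0n eqn0Ngt l_gt0.
by rewrite mulr0 add0r.
Qed.

Definition residue (x : 'Z_q) : 'F_p := (x : nat)%:R.

Let residue_nat n : residue n%:R = n%:R.
Proof. by rewrite /residue val_Zp_nat // natr_modq. Qed.

Let residueD x y : residue (x + y) = residue x + residue y.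
Proof. by rewrite -{1}[x]natr_Zp -{1}[y]natr_Zp -natrD residue_nat natrD. Qed.

Lemma residue_zmod_morphism : zmod_morphism residue.
Proof. by move=> x y; apply: (addIr (residue y)); rewrite -residueD !subrK. Qed.

Lemma residue_monoid_morphism : monoid_morphism residue.
Proof.
split; first by rewrite -[1](mulr1n 1) residue_nat.
by move=> x y; rewrite -{1}[x]natr_Zp -{1}[y]natr_Zp -natrM residue_nat natrM.
Qed.

Lemma unit_residue x : (x \is a GRing.unit) = (residue x != 0).
Proof.
rewrite -{1}[x]natr_Zp unitZpE // coprime_pexpl // prime_coprime //.
by rewrite (dvdn_pcharf (pchar_Fp pr_p)).
Qed.

Lemma ker_residue x : residue x = 0 -> exists y, x = p%:R * y.
Proof.
move/eqP; rewrite -(dvdn_pcharf (pchar_Fp pr_p)) => /dvdnP[k Ek].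
by exists k%:R; rewrite -natrM mulnC -Ek natr_Zp.
Qed.

Lemma p_nilpotent : p%:R ^+ l = 0 :> 'Z_q.
Proof. by rewrite -natrX pchar_Zp. Qed.

Lemma card_rV_Zq d : #|{: 'rV['Z_q]_d}| = (q ^ d)%N.
Proof. by rewrite card_mx mul1n card_ord Zp_cast. Qed.

Variable z : algC.
Hypothesis z_prim : q.-primitive_root z.

Definition zeta_char (x : 'Z_q) : algC := z ^+ x.

Let zeta_nat n : zeta_char n%:R = z ^+ n.
Proof. by rewrite /zeta_char val_Zp_nat // prim_expr_mod. Qed.

Lemma zeta_charP : addchar zeta_char.
Proof.
split=> [x y|x].
  by rewrite -{1}[x]natr_Zp -{1}[y]natr_Zp -natrD zeta_nat exprD.
rewrite normrX; suff -> : `|z| = 1 by rewrite expr1n.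
apply/eqP; rewrite -(@pexpr_eq1 _ _ q) //; last by rewrite ltnW.
by rewrite -normrX (prim_expr_order z_prim) normr1.
Qed.

Lemma zeta_char_prim y : residue y != 0 -> zeta_char (p%:R ^+ l.-1 * y) != 1.
Proof.
have -> : p%:R ^+ l.-1 * y = (p ^ l.-1 * y)%:R by rewrite natrM natr_Zp natrX.
apply: contraNneq; rewrite zeta_nat => /eqP.
rewrite -(prim_order_dvd z_prim) -{1}(prednK l_gt0) expnSr dvdn_pmul2l ?expn_gt0 ?prime_gt0 //.
by rewrite (dvdn_pcharf (pchar_Fp pr_p)).
Qed.

End ResidueRing.

Lemma Zunits_sub_distance_set (p l d : nat) (E : {set 'rV['Z_(p ^ l)]_d}) :
  prime p -> odd p -> (0 < l)%N -> (0 < d)%N ->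
  (16 * (p ^ l) ^ (2 * d) < p ^ d.-1 * #|E| ^ 2)%N ->
  Zunits (p ^ l) \subset distance_set E.
Proof.
move=> pr_p odd_p l_gt0 d_gt0 H; apply/subsetP => t; rewrite inE => ut.
apply/negPn/negP => nt; move: H; rewrite ltnNge => /negP; apply.
have q_gt0 : (0 < p ^ l)%N by rewrite expn_gt0 prime_gt0.
have [z z_prim] := C_prim_root_exists q_gt0.
pose rho : {rmorphism 'Z_(p ^ l) -> 'F_p} := HB.pack (@residue p l)
  (GRing.isZmodMorphism.Build _ _ (@residue p l) (residue_zmod_morphism pr_p l_gt0))
  (GRing.isMonoidMorphism.Build _ _ (@residue p l) (residue_monoid_morphism pr_p l_gt0)).
rewrite [(2 * d)%N]mulnC expnM -(card_rV_Zq pr_p l_gt0).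
apply: (@avoiding_card_le _ p l d rho pr_p odd_p l_gt0 _ _ _ t ut (zeta_char z) _ _ E) => //.
- exact: unit_residue.
- exact: ker_residue.
- exact: p_nilpotent.
- exact: zeta_charP.
- exact: zeta_char_prim.
(* [norm2] and [sqnorm] unfold to the same sum, so a pair at distance [t] would witness membership
   in [distance_set E]. *)
move=> x y xE yE; apply: contraNneq nt => <-.
by apply/imset2P; exists x y.
Qed.

(* From the finite inequality to the asymptotic statement *)
From mathcomp Require Import all_classical all_reals all_analysis.
Import numFieldNormedType.Exports.
Local Open Scope classical_set_scope.
Local Open Scope ring_scope.

(** The exponent is [((2l - 1) d + 1) / (2l)]; passing from [q] to [p] contributes a factor [l] and
    squaring a factor 2, so the denominator disappears. *)
Lemma size_bound_sqr (R : realType) (p l d : nat) : (0 < p)%N -> (0 < l)%N ->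
  ((p ^ l)%N%:R `^ ((2 * l%:R - 1) * d%:R / (2 * l%:R) + 1 / (2 * l%:R)) : R) ^+ 2 =
  p%:R ^+ ((2 * l - 1) * d + 1).
Proof.
move=> p0 l0; have l0' : l%:R != 0 :> R by rewrite pnatr_eq0 -lt0n.
rewrite natrX -powR_mulrn ?ler0n // -powRrM -powR_mulrn ?powR_ge0 // -powRrM -powR_mulrn ?ler0n //.
congr (_ `^ _).
rewrite natrD natrM natrB ?muln_gt0 // natrM.
by field.
Qed.

Theorem theorem1p3p1 (R : realType) (d : nat) (hd : (0 < d)%N)
    (p l : nat -> nat)
    (hp : forall n, prime (p n) /\ odd (p n))
    (hl : forall n, (0 < l n)%N)
    (E : forall n, {set 'rV['Z_(p n ^ l n)]_d})
    (hE : (fun n => (l n)%:R * ((l n)%:R + 1) *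
             ((p n ^ l n)%N%:R `^
               ((2 * (l n)%:R - 1) * d%:R / (2 * (l n)%:R) +
                1 / (2 * (l n)%:R))) : R)
          =o_\oo (fun n => #|E n|%:R : R)) :
  \forall n \near \oo, Zunits (p n ^ l n) \subset distance_set (E n).
Proof.
(* The constant [1/4] together with [l (l + 1) >= 2] gives [|E| >= 8x], hence [|E|^2 >= 64 x^2],
   which leaves room for the strict inequality with 16. *)
have /eqoP /(_ 4^-1) := hE; rewrite invr_gt0 ltr0n => /(_ isT).
apply: filterS => n; have [pr_p odd_p] := hp n; have l_gt0 := hl n.
have p_gt0 := prime_gt0 pr_p.
set x := _ `^ _ => H.
have x0 : 0 <= x by exact: powR_ge0.
have bound : 8 * x <= #|E n|%:R.
  move: H; rewrite normr_nat [4^-1 * _]mulrC ler_pdivlMr // => H; apply: le_trans H.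
  have l1 : 1 <= (l n)%:R :> R by rewrite ler1n.
  rewrite ger0_norm ?mulr_ge0 ?addr_ge0 ?ler0n //.
  have -> : 8 * x = 1 * (1 + 1) * x * 4 by ring.
  rewrite !ler_wpM2r // ler_pM // ?addr_ge0 // lerD2r //.
apply: Zunits_sub_distance_set => //.
have sq : (64 * p n ^ ((2 * l n - 1) * d + 1) <= #|E n| ^ 2)%N.
  rewrite -(ler_nat R) natrM !natrX -(size_bound_sqr R d p_gt0 l_gt0) -/x.
  have -> : 64%:R * x ^+ 2 = (8 * x) ^+ 2 by ring.
  by rewrite lerXn2r ?nnegrE ?mulr_ge0 ?ler0n.
apply: (@leq_trans (p n ^ d.-1 * (64 * p n ^ ((2 * l n - 1) * d + 1)))); last by rewrite leq_mul2l sq orbT.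
rewrite mulnCA -expnD -expnM.
(* The factor [p^(d-1)] completes the exponent to [2 l d], that is, to [q^(2d)]. *)
have -> : (d.-1 + ((2 * l n - 1) * d + 1) = l n * (2 * d))%N.
  have [k ->] : exists k, d = k.+1 by exists d.-1; rewrite prednK.
  have [m ->] : exists m, l n = m.+1 by exists (l n).-1; rewrite prednK.
  by rewrite !mulnS; lia.
by rewrite ltn_pmul2r // expn_gt0 p_gt0.
Qed.
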